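(* Let $n\ge 2$ and let $R=k[x_0,\dots,x_{n-1},y]$ with $\deg x_i=1$ and $\deg y=2$ (the coordinate ring of $\mathbb{P}(1^n,2)$). For $d\ge 1$ let $R^{(d)}$ be the degree $d$ Veronese subring, let $S\to R^{(d)}$ be a minimal surjection from a graded polynomial ring $S$, and let $N:=\dim\operatorname{Proj}(S)$ (so $S$, $R^{(d)}$ and $N$ depend on $d$). Then for each $1\le q\le n+1$ there exist constants $c_q, C_q$ (independent of $d$) such that, for all $d\gg 0$, $\beta^S_{i,i+q}(R^{(d)})\ne 0$ for all integers $i$ in the following ranges. If $d$ is even: - $q=1$: $\;1\le i\le N-C_1d^{\,n-1}$; - $2\le q\le n-1$: $\;c_q d^{\,q-1}\le i\le N-C_q d^{\,n-q}$; - $q=n$: $\;c_n d^{\,n-1}\le i\le N-n$; - $q=n+1$: the empty range. If $d$ is odd: - $q=1$: $\;1\le i\le N-C_1d^{\,n-1}$; - $2\le q\le n-1$: $\;c_q d^{\,q-2}\le i\le N-C_q d^{\,n-q}$; - $q=n$: $\;c_n d^{\,n-2}\le i\le N-n-(n \bmod 2)$; - $q=n+1$: $\;c_{n+1} d^{\,n-1}\le i\le N-n$.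
   Context: Here $k$ is a field. The degree $d$ Veronese subring is $R^{(d)}=\bigoplus_{e\ge 0}R_{ed}$, with grading rescaled by $d$: an element of $R_{ed}$ has degree $e$ in $R^{(d)}$. A minimal surjection $S\to R^{(d)}$ means: $S=k[z_0,\dots,z_N]$ is a graded polynomial ring whose variables $z_i$ correspond to the elements of a minimal set of (monomial) $k$-algebra generators of $R^{(d)}$, with $\deg z_i$ equal to the degree in $R$ of the corresponding monomial divided by $d$ (so $S$ may be nonstandard graded). $R^{(d)}$ is viewed as a graded $S$-module through this map. The graded Betti numbers are $\beta^S_{i,j}(M)=\dim_k \operatorname{Tor}^S_i(M,k)_{j}$. ''For $d\gg 0$'' means for all $d$ larger than some bound depending only on $n$. $(n\bmod 2)\in\{0,1\}$ is the remainder of $n$ modulo $2$. *)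

(* Defs.v *)
From HB Require Import structures.
From mathcomp Require Import all_boot all_order all_algebra.
From mathcomp.multinomials Require Export mpoly.
From Stdlib Require Import ClassicalEpsilon.

Set Implicit Arguments.
Unset Strict Implicit.
Unset Printing Implicit Defensive.

Import Order.TTheory GRing.Theory Num.Theory.
Local Open Scope ring_scope.

(* The weighted degree with deg 'X_i = w i; [p \is e.-homog for mwdeg w] says *)
(* that p lies in the degree e piece of the polynomial ring so graded.        *)
Definition mwdeg (r : nat) (w : 'I_r -> nat) (m : 'X_{1..r}) : nat :=
  (\sum_(i < r) m i * w i)%N.

Lemma mwdeg0 r (w : 'I_r -> nat) : mwdeg w 0%MM = 0%N.
Proof. by apply: big1 => i _; rewrite mnm0E. Qed.

Lemma mwdegD r (w : 'I_r -> nat) :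
  {morph mwdeg w : m1 m2 / (m1 + m2)%MM >-> (m1 + m2)%N}.
Proof.
by move=> m1 m2; rewrite -big_split; apply: eq_bigr => i _; rewrite mnmDE mulnDl.
Qed.

HB.instance Definition _ r (w : 'I_r -> nat) :=
  isMeasure.Build r (mwdeg w) (mwdeg0 w) (@mwdegD r w).

Section Veronese.
Variables (k : fieldType) (r : nat) (w : 'I_r -> nat) (d : nat).

Definition veronese_pred : pred {mpoly k[r]} :=
  fun p => all (fun m => d %| mwdeg w m)%N (msupp p).

Lemma veronese_predP (p : {mpoly k[r]}) :
  reflect {in msupp p, forall m, d %| mwdeg w m}%N (veronese_pred p).
Proof. exact: allP. Qed.

Fact veronese_closed : GRing.subsemialg_closed veronese_pred.
Proof.
split.
- by apply/veronese_predP => m; rewrite msupp1 inE => /eqP->; rewrite mwdeg0.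
- split; first by apply/veronese_predP => m; rewrite msupp0.
  move=> p q /veronese_predP hp /veronese_predP hq; apply/veronese_predP => m.
  by move/msuppD_le; rewrite mem_cat => /orP[/hp|/hq].
- move=> c p /veronese_predP hp; apply/veronese_predP => m /msuppZ_le.
  exact: hp.
- move=> p q /veronese_predP hp /veronese_predP hq; apply/veronese_predP => m.
  move/msuppM_le/allpairsP=> [[m1 m2] /= [h1 h2 ->]].
  by rewrite mwdegD dvdn_add //; [exact: hp | exact: hq].
Qed.

(* The Veronese subalgebra of the weighted polynomial ring, together with its *)
(* rescaled grading [veronese_deg].                                           *)
Record veronese := Veronese { veronese_val :> {mpoly k[r]};
                              _ : veronese_pred veronese_val }.

HB.instance Definition _ := [isSub for veronese_val].
HB.instance Definition _ := [Choice of veronese by <:].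
HB.instance Definition _ :=
  GRing.SubChoice_isSubAlgebra.Build k _ veronese_pred veronese veronese_closed.
HB.instance Definition _ :=
  GRing.SubNzRing_isSubComNzRing.Build _ veronese_pred veronese.

Definition veronese_deg (e : nat) : {pred veronese} :=
  fun f => veronese_val f \is (d * e)%N.-homog for (mwdeg w).

End Veronese.

Section RestrictScalars.
Variables S A : nzRingType.

(* A, viewed as an S-module through phi. *)
Definition restrict_scalars (phi : {rmorphism S -> A}) : Type := A.

Variable phi : {rmorphism S -> A}.
Local Notation M := (restrict_scalars phi).

HB.instance Definition _ := GRing.Zmodule.on M.

Definition rs_scale (s : S) (a : M) : M := phi s * (a : A).

Fact rs_scaleA s t a : rs_scale s (rs_scale t a) = rs_scale (s * t) a.
Proof. by rewrite /rs_scale rmorphM mulrA. Qed.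
Fact rs_scale1 : left_id 1 rs_scale.
Proof. by move=> a; rewrite /rs_scale rmorph1 mul1r. Qed.
Fact rs_scaleDr : right_distributive rs_scale +%R.
Proof. by move=> s a b; rewrite /rs_scale mulrDr. Qed.
Fact rs_scaleDl a : {morph rs_scale^~ a : s t / s + t}.
Proof. by move=> s t; rewrite /rs_scale rmorphD mulrDl. Qed.

HB.instance Definition _ := GRing.Zmodule_isLmodule.Build S M
  rs_scaleA rs_scale1 rs_scaleDr rs_scaleDl.

End RestrictScalars.

Section Betti.
Variables (k : fieldType) (r : nat) (w : 'I_r -> nat).
Local Notation S := {mpoly k[r]}.
Variables (M : lmodType S) (Mdeg : nat -> {pred M}).

(* A graded resolution of M (with graded pieces Mdeg e) by the finite free    *)
(* modules F_i = \bigoplus_a S(- fr_deg i a), elements being row vectors; the *)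
(* a-th basis vector of F_i+1 is sent to row a of [fr_d i], and the a-th      *)
(* basis vector of F_0 to [fr_aug a].                                         *)
Record graded_free_resolution := GradedFreeResolution {
  fr_rank : nat -> nat;
  fr_deg : forall i, 'I_(fr_rank i) -> nat;
  fr_aug : 'I_(fr_rank 0) -> M;
  fr_d : forall i, 'M[S]_(fr_rank i.+1, fr_rank i);
  fr_aug_homog : forall a, fr_aug a \in Mdeg (fr_deg a);
  fr_d_homog : forall i a b m, m \in msupp (fr_d i a b) ->
    (mwdeg w m + fr_deg b = fr_deg a)%N;
  fr_exact_M : forall x : M, exists v : 'rV[S]_(fr_rank 0),
    x = \sum_a v 0 a *: fr_aug a;
  fr_exact_0 : forall v : 'rV[S]_(fr_rank 0),
    \sum_a v 0 a *: fr_aug a = 0 <->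
    exists u : 'rV[S]_(fr_rank 1), v = u *m fr_d 0;
  fr_exact_S : forall i (v : 'rV[S]_(fr_rank i.+1)),
    v *m fr_d i = 0 <->
    exists u : 'rV[S]_(fr_rank i.+2), v = u *m fr_d i.+1
}.

Variable F : graded_free_resolution.

(* F_i tensored with k = S / (z_0, z_1, ...) is k^(fr_rank F i), with         *)
(* differential the matrix of constant terms (the weights w being positive).  *)
Definition fr_dk (i : nat) : 'M[k]_(fr_rank F i.+1, fr_rank F i) :=
  map_mx (mcoeff 0%MM) (fr_d F i).

Definition fr_cycles (i : nat) : 'M[k]_(fr_rank F i) :=
  match i return 'M[k]_(fr_rank F i) with
  | 0 => 1%:M
  | i'.+1 => kermx (fr_dk i')
  end.

(* Its row space is the degree j piece of F_i tensored with k. *)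
Definition fr_piece (i j : nat) : 'M[k]_(fr_rank F i) :=
  diag_mx (\row_a (fr_deg a == j)%:R).

Definition tor_dim (i j : nat) : nat :=
  (\rank (fr_cycles i :&: fr_piece i j)%MS
   - \rank (fr_dk i :&: fr_piece i j)%MS)%N.

End Betti.

(* The graded Betti number dim_k Tor_i(M, k)_j, computed on a chosen graded   *)
(* free resolution. If there is none, the value is unspecified.               *)
Definition betti (k : fieldType) (r : nat) (w : 'I_r -> nat)
    (M : lmodType {mpoly k[r]}) (Mdeg : nat -> {pred M}) (i j : nat) : nat :=
  epsilon (inhabits 0%N)
    (fun b => exists F : graded_free_resolution w Mdeg, b = tor_dim F i j).

Section MinimalSurjection.
Variables (k : fieldType) (r : nat) (w : 'I_r -> nat) (d : nat).
Variables (s : nat) (z : 'I_s -> nat).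
Variable phi : {lrmorphism {mpoly k[s]} -> veronese k w d}.

Definition involves_only (P : {set 'I_s}) (p : {mpoly k[s]}) : Prop :=
  forall m i, m \in msupp p -> m i != 0%N -> i \in P.

(* The images of the variables in P generate the Veronese as a k-algebra. *)
Definition generates (P : {set 'I_s}) : Prop :=
  forall f, exists2 p, involves_only P p & phi p = f.

(* The variables map to a minimal set of monomial generators, deg 'X_i = z i. *)
Definition minimal_surjection : Prop :=
  [/\ forall i, exists2 m, veronese_val (phi 'X_i) = 'X_[m]
                         & mwdeg w m = (d * z i)%N,
      generates [set: 'I_s]
    & forall P : {set 'I_s}, P \proper [set: 'I_s] -> ~ generates P].

End MinimalSurjection.

(* Weights of k[x_0, ..., x_(n-1), y], where y is the last variable. *)
Definition weights_1n2 (n : nat) (i : 'I_n.+1) : nat :=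
  if i == ord_max then 2 else 1.

Definition between (lo hi : rat) (i : nat) : bool := lo <= i%:R <= hi.

Definition nonvanishing_range (n d N q : nat) (c C : rat) (i : nat) : Prop :=
  if odd d then
    [\/ q = 1%N /\ between 1 (N%:R - C * d%:R ^+ (n - 1)) i,
        (2 <= q <= n - 1)%N /\
          between (c * d%:R ^+ (q - 2)) (N%:R - C * d%:R ^+ (n - q)) i,
        q = n /\
          between (c * d%:R ^+ (n - 2)) (N%:R - n%:R - (n %% 2)%:R) i
      | q = n.+1 /\ between (c * d%:R ^+ (n - 1)) (N%:R - n%:R) i]
  else (* the range is empty for q = n + 1 *)
    [\/ q = 1%N /\ between 1 (N%:R - C * d%:R ^+ (n - 1)) i,
        (2 <= q <= n - 1)%N /\
          between (c * d%:R ^+ (q - 1)) (N%:R - C * d%:R ^+ (n - q)) i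
      | q = n /\ between (c * d%:R ^+ (n - 1)) (N%:R - n%:R) i].

(* Main.v *)
Require Import Defs.
From HB Require Import structures.
From mathcomp Require Import all_boot all_order all_algebra.
From mathcomp.multinomials Require Import mpoly.
From mathcomp Require Import zify.
From Stdlib Require Import ClassicalEpsilon.
Set Implicit Arguments.
Unset Strict Implicit.
Unset Printing Implicit Defensive.
Import Order.TTheory GRing.Theory.
Local Open Scope ring_scope.

(** Write M for the Veronese ring, a module over the polynomial ring S, and identify
    a variable of S with the monomial of R = k[x_0, ..., x_(n-1), y] to which it
    maps.  Tor(M, k) is the homology of the Koszul complex of the variables of S
    with coefficients in M, and nonzero classes can be written down by hand; this is
    the monomial method of Ein, Erman and Lazarsfeld.

    Among the variables of S are pure powers l_c of all the variables of R.  Let m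
    be a monomial of degree dq that no l_c divides, and let P be a set of other
    variables of S such that each v in P kills m modulo the pure powers, and such
    that every variable dividing m is in P.  Modulo the pure powers, the wedge of
    the e_v, v in P, with coefficient m is a cycle.  It lifts to M: if l_v is a pure
    power dividing m v, replace e_v by e_v - (v / l_v) e_(l_v).  The denominators
    disappear, because the pure powers in a nonzero wedge product are distinct and
    so involve distinct variables of R.  In the multidegree of this class the Koszul
    complex is the chain complex of a simplicial complex, and the class is the
    product of the differences e_v - e_(l_v) ([cross_chain], [cross_support]).  It
    is not a boundary: the coefficient m of the face P could only come from a
    variable outside P dividing m.  Hence row q has a nonzero Betti number in
    column i as soon as, for some m of degree dq, the divisors of m among the
    variables are killers, at most i in number, and there are at least i killers
    ([tor_dim_neq0], [betti_neq0]).

    The Betti numbers of the statement are read off from an unspecified resolution F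
    by graded free modules of finite rank.  One exists by the Hilbert basis theorem,
    proved from Dickson's lemma ([hilbert_basis], [resolution_exists]).  For any F a
    chase through the double complex of Koszul chains with coefficients in F, whose
    Koszul direction is exact ([koszul_acyclic]), shows that if F tensored with k
    has no homology in a bidegree, then every Koszul cycle there is a boundary
    ([koszul_boundary_of_tor_dim]).

    In a minimal surjection the variables correspond to the irreducible elements of
    the monoid of monomials of degree divisible by d ([mon_irreducible],
    [irreducible_var]); these are the monomials of degree d and, for odd d, also
    y^d ([irreducible_1n2]).  There are N + 1 of them, n + 1 of which are the pure
    powers, so all that is left is to choose m and to bound from above the number of
    its divisors and of the variables not killing it.  With q saturated exponents in
    the x_c ([full_x]) these numbers are O(d^(q-1)) and O(d^(n-q)).  For odd d,
    saturating y, which then has pure power y^d of degree 2d, uses up two units of q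
    with one variable ([full_xy]): only O(d^(q-2)) divisors remain, and the killers
    contain all generators divisible by y, whose number has order d^n, so that this
    range overlaps the previous one.  In row n the last step is a monomial
    ([near_socle]) killed by everything but one generator at most, which exists when
    d and n are odd; in row n + 1 the degree of a product of m by a generator
    already exceeds that of every monomial outside the ideal of the pure powers. *)

(** * The Koszul complex and exterior multiplication *)

Section Koszul.
Variable S : comNzRingType.

(** The differential of the Koszul complex as an iterated mapping cone, one cone for
    each element of zs.  A face is the bit string of its indicator function and a
    chain is a function of the face; only strings as long as zs matter. *)
Fixpoint koszul_d (M : lmodType S) (zs : seq S) (c : seq bool -> M)
    (T : seq bool) : M :=
  match zs, T with
  | z :: zs', b :: T' =>
      if b then - koszul_d zs' (fun U => c (true :: U)) T'
      else koszul_d zs' (fun U => c (false :: U)) T' + z *: c (true :: T')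
  | _, _ => 0
  end.

(** Exterior multiplication on the left by the sum of the vs`_i e_i. *)
Fixpoint wedge (M : lmodType S) (vs : seq S) (c : seq bool -> M)
    (T : seq bool) : M :=
  match vs, T with
  | v :: vs', b :: T' =>
      if b then v *: c (false :: T') - wedge vs' (fun U => c (true :: U)) T'
      else wedge vs' (fun U => c (false :: U)) T'
  | _, _ => 0
  end.

Lemma eq_koszul_d (M : lmodType S) (zs : seq S) (c c' : seq bool -> M) :
  (forall U, size U = size zs -> c U = c' U) ->
  forall T, size T = size zs -> koszul_d zs c T = koszul_d zs c' T.
Proof.
elim: zs c c' => [|z zs IH] c c' cc' [|b T] //= [sT].
have IHb a : koszul_d zs (fun U => c (a :: U)) T
           = koszul_d zs (fun U => c' (a :: U)) T.
  by apply: IH => // U sU; apply: cc' => /=; rewrite sU.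
by case: b; rewrite !IHb // cc' //= sT.
Qed.

Lemma koszul_dP (M : lmodType S) (zs : seq S) a (c c' : seq bool -> M) T :
  koszul_d zs (fun U => a *: c U + c' U) T
  = a *: koszul_d zs c T + koszul_d zs c' T.
Proof.
elim: zs c c' T => [|z zs IH] c c' [|b T] //=; rewrite ?scaler0 ?addr0 //.
case: b; rewrite IH; first by rewrite opprD scalerN.
by rewrite !scalerDr addrACA !scalerA mulrC.
Qed.

Lemma koszul_dD (M : lmodType S) (zs : seq S) (c c' : seq bool -> M) T :
  koszul_d zs (fun U => c U + c' U) T = koszul_d zs c T + koszul_d zs c' T.
Proof.
elim: zs c c' T => [|z zs IH] c c' [|b T] //=; rewrite ?addr0 //.
by case: b; rewrite IH ?opprD // scalerDr addrACA.
Qed.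

Lemma koszul_dZ (M : lmodType S) (zs : seq S) a (c : seq bool -> M) T :
  koszul_d zs (fun U => a *: c U) T = a *: koszul_d zs c T.
Proof.
elim: zs c T => [|z zs IH] c [|b T] //=; rewrite ?scaler0 //.
by case: b; rewrite IH ?scalerN // scalerDr !scalerA mulrC.
Qed.

Lemma koszul_dN (M : lmodType S) (zs : seq S) (c : seq bool -> M) T :
  koszul_d zs (fun U => - c U) T = - koszul_d zs c T.
Proof.
elim: zs c T => [|z zs IH] c [|b T] //=; rewrite ?oppr0 //.
by case: b; rewrite IH // scalerN opprD.
Qed.

Lemma koszul_d_linear (M M' : lmodType S) (f : {linear M -> M'}) (zs : seq S)
    (c : seq bool -> M) T :
  koszul_d zs (fun U => f (c U)) T = f (koszul_d zs c T).
Proof.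
elim: zs c T => [|z zs IH] c [|b T] //=; rewrite ?linear0 //.
by case: b; rewrite IH ?linearN // linearD linearZ.
Qed.

Lemma koszul_dd (M : lmodType S) (zs : seq S) (c : seq bool -> M) T :
  koszul_d zs (koszul_d zs c) T = 0.
Proof.
elim: zs c T => [|z zs IH] c [|b T] //=.
case: b; first by rewrite koszul_dN IH !oppr0.
by rewrite koszul_dD koszul_dZ IH scalerN add0r subrr.
Qed.


(** This replaces the closed formula for the differential: no property used below
    depends on the signs of the terms. *)
Lemma koszul_d_ind (M : lmodType S) (Q : M -> Prop) :
  Q 0 -> (forall x y, Q x -> Q y -> Q (x + y)) -> (forall x, Q x -> Q (- x)) ->
  forall (zs : seq S) (c : seq bool -> M) T, size T = size zs ->
  (forall l, (l < size zs)%N -> nth false T l = false ->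
     Q (zs`_l *: c (set_nth false T l true))) ->
  Q (koszul_d zs c T).
Proof.
move=> Q0 QD QN; elim=> [|z zs IH] c [|b T] //= [sT] QT.
have Qb : Q (koszul_d zs (fun U => c (b :: U)) T).
  by apply: IH => // l ls Tl; apply: (QT l.+1).
by case: b QT Qb => QT Qb; [apply: QN | apply: QD => //; apply: (QT 0%N)].
Qed.

Lemma wedge_ind (M : lmodType S) (Q : M -> Prop) :
  Q 0 -> (forall x y, Q x -> Q y -> Q (x + y)) -> (forall x, Q x -> Q (- x)) ->
  forall (vs : seq S) (c : seq bool -> M) T, size T = size vs ->
  (forall l, (l < size vs)%N -> nth false T l ->
     Q (vs`_l *: c (set_nth false T l false))) ->
  Q (wedge vs c T).
Proof.
move=> Q0 QD QN; elim=> [|v vs IH] c [|b T] //= [sT] QT.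
have Qb : Q (wedge vs (fun U => c (b :: U)) T).
  by apply: IH => // l ls Tl; apply: (QT l.+1).
case: b QT Qb => QT Qb //; apply: QD; last exact: QN.
exact: (QT 0%N).
Qed.

Lemma koszul_d_eq0 (M : lmodType S) (zs : seq S) (c : seq bool -> M) T :
  size T = size zs ->
  (forall l, (l < size zs)%N -> nth false T l = false ->
     zs`_l *: c (set_nth false T l true) = 0) ->
  koszul_d zs c T = 0.
Proof.
move=> sT; apply: (koszul_d_ind (Q := fun x => x = 0)) => //.
  by move=> x y -> ->; rewrite addr0.
by move=> x ->; rewrite oppr0.
Qed.

Lemma wedge_eq0 (M : lmodType S) (vs : seq S) (c : seq bool -> M) T :
  size T = size vs ->
  (forall l, (l < size vs)%N -> nth false T l ->
     vs`_l *: c (set_nth false T l false) = 0) ->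
  wedge vs c T = 0.
Proof.
move=> sT; apply: (wedge_ind (Q := fun x => x = 0)) => //.
  by move=> x y -> ->; rewrite addr0.
by move=> x ->; rewrite oppr0.
Qed.

Lemma wedgeN (M : lmodType S) (vs : seq S) (c : seq bool -> M) T :
  wedge vs (fun U => - c U) T = - wedge vs c T.
Proof.
elim: vs c T => [|v vs IH] c [|b T] //=; rewrite ?oppr0 //.
by case: b; rewrite IH // scalerN opprD.
Qed.

Lemma wedgeP (M : lmodType S) (vs : seq S) a (c c' : seq bool -> M) T :
  wedge vs (fun U => c U + a *: c' U) T = wedge vs c T + a *: wedge vs c' T.
Proof.
elim: vs c c' T => [|v vs IH] c c' [|b T] //=; rewrite ?scaler0 ?addr0 //.
case: b; rewrite IH //.
by rewrite scalerDr scalerBr opprD addrACA !scalerA mulrC.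
Qed.

(** The differential is a derivation of the exterior algebra, and maps the vector
    with coordinates vs to the pairing of vs and zs. *)
Lemma koszul_d_wedge (M : lmodType S) (zs vs : seq S) (c : seq bool -> M) T :
  size vs = size zs -> size T = size zs ->
  koszul_d zs (wedge vs c) T + wedge vs (koszul_d zs c) T
  = (\sum_(i < size zs) vs`_i * zs`_i) *: c T.
Proof.
elim: zs vs c T => [|z zs IH] [|v vs] c [|b T] //=.
  by rewrite big_ord0 scale0r addr0.
move=> [svs] [sT]; rewrite big_ord_recl /= scalerDl.
rewrite (_ : \sum_i _ = \sum_(i < size zs) vs`_i * zs`_i); last exact: eq_bigr.
rewrite -(IH vs (fun U => c (b :: U)) T) //.
case: b.
  rewrite koszul_dP koszul_dN (wedgeN vs (koszul_d zs (fun U => c (true :: U)))).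
  rewrite opprB opprK scalerDr scalerA.
  set A := v *: _; set B := koszul_d _ _ _; set C := wedge _ _ _.
  by rewrite !addrA subrK [_ + B]addrC.

rewrite (wedgeP vs z (koszul_d zs (fun U => c (false :: U)))).
by rewrite scalerBr scalerA [z * v]mulrC addrACA subrK addrC.
Qed.

(** When only one coordinate of vs can be split off the face T, exterior
    multiplication has a single term at T. *)
Lemma wedge_eq1 (M : lmodType S) (vs : seq S) (c : seq bool -> M) T j :
  size T = size vs -> nth false T j ->
  (forall l, l != j -> nth false T l -> vs`_l = 0) ->
  exists b : bool,
    wedge vs c T = (-1) ^+ b *: (vs`_j *: c (set_nth false T j false)).
Proof.
elim: vs c T j => [|v vs IH] c [|b T] [|j] //= [sT] Tj v0.
  exists false; rewrite expr0 scale1r Tj [X in _ - X](_ : _ = 0) ?subr0 //.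
  by apply: wedge_eq0 => // l _ Tl; rewrite [vs`_l](v0 l.+1) // scale0r.
have [|e we] := IH (fun U => c (b :: U)) T j sT Tj.
  by move=> l nl Tl; apply: (v0 l.+1); rewrite ?eqSS.
case: b v0 we => v0 we; last by exists e.
exists (~~ e); rewrite [v](v0 0%N) // scale0r add0r we -scaleNr; congr (_ *: _).
by case: (e); rewrite /= ?expr0 ?expr1 ?opprK.
Qed.

End Koszul.

(** * Acyclicity of the Koszul complex of variables *)

Section MonomialFilter.
Variables (k : fieldType) (s : nat).
Implicit Types (p q : {mpoly k[s]}) (Q : pred 'X_{1..s}).

(** Projection onto the monomials satisfying Q, for instance those of a given
    weighted degree. *)
Definition mfilter Q p : {mpoly k[s]} :=
  \sum_(m <- msupp p | Q m) p@_m *: 'X_[m].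

Lemma mcoeff_mfilter Q p m : (mfilter Q p)@_m = if Q m then p@_m else 0.
Proof.
rewrite raddf_sum /=.
rewrite (eq_bigr (fun m' => if m' == m then p@_m else 0)); last first.
  by move=> m' _; rewrite mcoeffZ mcoeffX; case: eqP => [->|_];
     rewrite ?mulr1 ?mulr0.
rewrite -big_mkcondr /=; have [pm|pm] := boolP (m \in msupp p).
  rewrite big_mkcond (bigD1_seq m) ?msupp_uniq //= eqxx andbT big1_seq ?addr0 //.
  by move=> i /andP[/negPf-> _]; rewrite andbF.
by rewrite (memN_msupp_eq0 pm) if_same big1.
Qed.

Lemma msupp_mfilter Q p m : (m \in msupp (mfilter Q p)) = Q m && (m \in msupp p).
Proof. by rewrite !mcoeff_msupp mcoeff_mfilter; case: (Q m) => //; rewrite eqxx. Qed.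

Lemma mfilterC Q p : mfilter Q p + mfilter (predC Q) p = p.
Proof.
apply/mpolyP => m; rewrite mcoeffD !mcoeff_mfilter /=.
by case: (Q m); rewrite ?addr0 ?add0r.
Qed.

Lemma mem_msuppD p q m :
  m \in msupp (p + q) -> (m \in msupp p) || (m \in msupp q).
Proof. by move/msuppD_le; rewrite mem_cat. Qed.

Lemma mem_msuppN p m : (m \in msupp (- p)) = (m \in msupp p).
Proof. by rewrite !mcoeff_msupp mcoeffN oppr_eq0. Qed.

Lemma mcoeff_mulX p u m :
  ('X_[u] * p)@_m = if (u <= m)%MM then p@_(m - u) else 0.
Proof.
case: ifP => [/submK um|um].
  by rewrite mulrC -{1}um addmC mcoeffMX.
apply/memN_msupp_eq0/negP; rewrite mulrC (perm_mem (msuppMX p u)).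
by case/mapP => m' _ mE; rewrite mE lem_addr in um.
Qed.

(** Membership in the ideal generated by the variables of L, read off from the
    monomials. *)
Definition in_var_ideal (L : seq 'I_s) p : Prop :=
  forall m, m \in msupp p -> has (fun l => m l != 0%N) L.

Lemma in_var_ideal0 L : in_var_ideal L 0.
Proof. by move=> m; rewrite mcoeff_msupp mcoeff0 eqxx. Qed.

Lemma in_var_idealD L p q :
  in_var_ideal L p -> in_var_ideal L q -> in_var_ideal L (p + q).
Proof. by move=> hp hq m /mem_msuppD /orP[/hp|/hq]. Qed.

Lemma in_var_idealN L p : in_var_ideal L p -> in_var_ideal L (- p).
Proof. by move=> hp m; rewrite mem_msuppN => /hp. Qed.

Lemma in_var_ideal_mulX L l p : l \in L -> in_var_ideal L ('X_l * p).
Proof.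
move=> lL m; rewrite mcoeff_msupp mcoeff_mulX lep1mP; case: ifP => [ml _|].
  by apply/hasP; exists l.
by rewrite eqxx.
Qed.

(** A variable outside L is a nonzerodivisor modulo the variables in L. *)
Lemma in_var_ideal_cancel L l p :
  l \notin L -> in_var_ideal L ('X_l * p) -> in_var_ideal L p.
Proof.
move=> lL hp m pm; have /hp : (m + U_(l))%MM \in msupp ('X_l * p).
  by rewrite mcoeff_msupp mcoeff_mulX lem_addl addmK -mcoeff_msupp.
case/hasP => i iL; rewrite mnmDE mnm1E => mi; apply/hasP; exists i => //.
have /negPf li : l != i by apply: contraNneq lL => ->.
by move: mi; rewrite li addn0.
Qed.

Lemma in_var_ideal_cons L l p : in_var_ideal (l :: L) p ->
  exists a b, p = 'X_l * a + b /\ in_var_ideal L b.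
Proof.
move=> hp; pose Q (m : 'X_{1..s}) := m l != 0%N.
pose a := \sum_(m <- msupp p | Q m) p@_m *: 'X_[(m - U_(l))%MM] : {mpoly k[s]}.
exists a, (mfilter (predC Q) p); split.
  rewrite -{1}(mfilterC Q p) mulr_sumr; congr (_ + _); apply: eq_bigr => m Qm.
  by rewrite -scalerAr -mpolyXD addmC submK // lep1mP.
move=> m; rewrite msupp_mfilter => /andP[/= /negPn/eqP ml /hp /=].
by rewrite ml.
Qed.

End MonomialFilter.

Section Acyclic.
Variables (k : fieldType) (s : nat).
Local Notation S := {mpoly k[s]}.
Local Notation X L := [seq 'X_l : S | l <- L].
Local Notation kd M := (@koszul_d S M).

Lemma koszul_d_const (M : lmodType S) zs (c : seq bool -> M) T :
  (forall U, has id U -> c U = 0) -> size T = size zs -> kd M zs c T = 0.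
Proof.
move=> c0 sT; apply: koszul_d_eq0 => // l ls _; rewrite c0 ?scaler0 //.
by apply/hasP; exists true => //; apply/(nthP false); exists l;
   rewrite ?nth_set_nth /= ?eqxx // size_set_nth; apply: leq_trans (leq_maxl _ _).
Qed.

(** The variables form a regular sequence.  All homological degrees are treated at
    once, so degree 0 contributes the condition that the value at the empty face lie
    in the ideal of the variables.  The induction views the complex as the cone of
    multiplication by one variable on the complex of the others. *)
Lemma koszul_acyclic (L : seq 'I_s) (c : seq bool -> S^o) : uniq L ->
  (forall T, size T = size L -> kd S^o (X L) c T = 0) ->
  in_var_ideal L (c (nseq (size L) false)) ->
  exists e, forall T, size T = size L -> kd S^o (X L) e T = c T.
Proof.
elim: L c => [|l L IH] c /=.
  move=> _ _ h; exists (fun=> 0) => -[|//] _ /=; apply/esym/eqP.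
  by rewrite -msupp_eq0; move: h; rewrite /in_var_ideal; case: (msupp _) => // m q /(_ m (mem_head m q)).
case/andP=> lL uL dc hc.
pose c0 U := c (false :: U); pose c1 U := c (true :: U).
have dc1 T : size T = size L -> kd S^o (X L) c1 T = 0.
  move=> sT; have /= := dc (true :: T); rewrite sT => /(_ erefl)/eqP.
  by rewrite oppr_eq0 => /eqP.
have dc0 T : size T = size L -> kd S^o (X L) c0 T + 'X_l * c1 T = 0.
  by move=> sT; have /= := dc (false :: T); rewrite sT => /(_ erefl).
set o := nseq (size L) false in hc.
have so : size o = size L by rewrite size_nseq.
have [|e1 de1] := IH c1 uL dc1.
  apply: (in_var_ideal_cancel lL).
  have /eqP := dc0 _ so; rewrite addrC addr_eq0 => /eqP ->.
  apply: in_var_idealN; apply: koszul_d_ind.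
  - exact: in_var_ideal0.
  - by move=> x y; apply: in_var_idealD.
  - by move=> x; apply: in_var_idealN.
  - by rewrite size_map.
  move=> i; rewrite size_map => iL _; rewrite (nth_map l) //.
  by apply: in_var_ideal_mulX; rewrite mem_nth.
have [a [b [cab Lb]]] := in_var_ideal_cons hc.
(* Changing e1 at the empty face keeps its differential; the correction moves the
   value of c0 + 'X_l * e1' there into the ideal of L. *)
pose e1' U : S^o := e1 U + (if has id U then 0 else - a - e1 o).
have de1' T : size T = size L -> kd S^o (X L) e1' T = c1 T.
  move=> sT; rewrite koszul_dD de1 // koszul_d_const ?addr0 ?size_map //.
  by move=> U ->.
have [||e0 de0] := IH (fun U => c0 U + 'X_l * e1' U) uL.
- move=> T sT; rewrite koszul_dD (koszul_dZ _ ('X_l : S) (e1' : _ -> S^o)) de1' //.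
  exact: dc0.
- rewrite -/o /c0 cab /e1' has_nseq andbF [e1 o + _]addrC subrK.
  by rewrite mulrN addrAC subrr add0r.
exists (fun U => if U is b :: U' then if b then - e1' U' else e0 U' else 0).
case=> [|[] T] //= [sT].
  by rewrite koszul_dN opprK de1'.
by rewrite de0 // scalerN addrK.
Qed.

Lemma koszul_d_entry n (c : seq bool -> 'rV[S]_n) zs T a :
  kd _ zs c T 0 a = kd S^o zs (fun U => c U 0 a) T.
Proof.
elim: zs c T => [|z zs IH] c [|b T] //=; rewrite ?mxE //.
by case: b; rewrite !mxE IH.
Qed.

Lemma koszul_acyclic_row n (L : seq 'I_s) (c : seq bool -> 'rV[S]_n) : uniq L ->
  (forall T, size T = size L -> kd _ (X L) c T = 0) ->
  (forall a, in_var_ideal L (c (nseq (size L) false) 0 a)) ->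
  exists e, forall T, size T = size L -> kd _ (X L) e T = c T.
Proof.
move=> uL dc hc.
have /fin_all_exists [e de] a : exists e : seq bool -> S^o,
    forall T, size T = size L -> kd S^o (X L) e T = c T 0 a.
  by apply: koszul_acyclic => // T sT; rewrite -koszul_d_entry dc // mxE.
exists (fun T => \row_a e a T) => T sT; apply/rowP => a.
rewrite koszul_d_entry -(de a) //; apply: (eq_koszul_d (M := S^o)).
  by move=> U _; rewrite mxE.
by rewrite size_map.
Qed.

End Acyclic.

(** * Comparison of a free resolution with the Koszul complex *)

Section Homogeneous.
Variables (k : fieldType) (s : nat) (z : 'I_s -> nat).
Local Notation S := {mpoly k[s]}.

Lemma mem_msuppM (p q : S) m : m \in msupp (p * q) ->
  exists m1 m2, [/\ m1 \in msupp p, m2 \in msupp q & m = (m1 + m2)%MM].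
Proof. by move/msuppM_le/allpairsP => [[m1 m2] /= [? ? ->]]; exists m1, m2. Qed.

Lemma mfilterD Q (p q : S) : mfilter Q (p + q) = mfilter Q p + mfilter Q q.
Proof.
by apply/mpolyP => m; rewrite mcoeffD !mcoeff_mfilter mcoeffD; case: ifP;
   rewrite ?addr0.
Qed.

Lemma mfilter_id (Q : pred 'X_{1..s}) (p : S) : {in msupp p, forall m, Q m} -> mfilter Q p = p.
Proof.
move=> h; apply/mpolyP => m; rewrite mcoeff_mfilter; case: ifPn => // nQ.
by apply/esym/memN_msupp_eq0; apply: contra nQ => /h.
Qed.

Lemma mfilter_eq0 (Q : pred 'X_{1..s}) (p : S) : {in msupp p, forall m, ~~ Q m} -> mfilter Q p = 0.
Proof.
move=> h; apply/mpolyP => m; rewrite mcoeff_mfilter mcoeff0; case: ifPn => // Qm.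
by apply/memN_msupp_eq0; apply/negP => /h; rewrite Qm.
Qed.

Lemma mfilter_sum (I : finType) Q (f : I -> S) :
  mfilter Q (\sum_i f i) = \sum_i mfilter Q (f i).
Proof.
apply: (big_morph _ (mfilterD Q)).
by apply: mfilter_eq0 => m; rewrite mcoeff_msupp mcoeff0 eqxx.
Qed.

(** The part of a row vector in a fixed total degree, where the a-th basis vector
    has degree dg a. *)
Definition row_part p (dg : 'I_p -> nat) (e : nat) (u : 'rV[S]_p) : 'rV[S]_p :=
  \row_a mfilter (fun m => mwdeg z m + dg a == e)%N (u 0 a).

Lemma row_partP p (dg : 'I_p -> nat) e u a m :
  m \in msupp (row_part dg e u 0 a) -> (mwdeg z m + dg a = e)%N.
Proof. by rewrite mxE msupp_mfilter => /andP[/eqP]. Qed.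

Lemma row_part_id p (dg : 'I_p -> nat) e (u : 'rV[S]_p) :
  (forall a m, m \in msupp (u 0 a) -> (mwdeg z m + dg a = e)%N) ->
  row_part dg e u = u.
Proof.
by move=> h; apply/rowP => a; rewrite mxE mfilter_id // => m /h ->.
Qed.

(** Homogeneous matrices commute with taking parts; this makes all liftings through
    the resolution homogeneous. *)
Lemma row_part_mulmx p q (dg : 'I_p -> nat) (dg' : 'I_q -> nat)
    (D : 'M[S]_(p, q)) (e : nat) (u : 'rV[S]_p) :
  (forall a b m, m \in msupp (D a b) -> (mwdeg z m + dg' b = dg a)%N) ->
  row_part dg' e (u *m D) = row_part dg e u *m D.
Proof.
move=> hD; apply/rowP => b; rewrite !mxE mfilter_sum; apply: eq_bigr => a _.
pose Q m := (mwdeg z m + dg a == e)%N; rewrite mxE -/Q.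
rewrite -[in LHS](mfilterC Q (u 0 a)) mulrDl mfilterD.
rewrite mfilter_id; last first.
  move=> m /mem_msuppM[m1 [m2 [+ h2 ->]]].
  by rewrite msupp_mfilter /= mwdegD -addnA (hD _ _ _ h2) => /andP[].
rewrite [X in _ + X]mfilter_eq0 ?addr0 // => m /mem_msuppM[m1 [m2 [+ h2 ->]]].
by rewrite msupp_mfilter /= mwdegD -addnA (hD _ _ _ h2) => /andP[].
Qed.

End Homogeneous.

Section Balance.
Variables (k : fieldType) (s : nat) (z : 'I_s -> nat).
Local Notation S := {mpoly k[s]}.
Variables (M : lmodType S) (Mdeg : nat -> {pred M}).
Variable F : graded_free_resolution z Mdeg.
Local Notation X := [seq 'X_l : S | l <- enum 'I_s].
Local Notation kd := (koszul_d X).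

Definition augmentation (v : 'rV[S]_(fr_rank F 0)) : M :=
  \sum_a v 0 a *: fr_aug a.

Fact augmentation_is_linear : linear augmentation.
Proof.
move=> a u v; rewrite /augmentation scaler_sumr -big_split /=.
by apply: eq_bigr => b _; rewrite !mxE scalerDl scalerA.
Qed.

HB.instance Definition _ := GRing.isLinear.Build _ _ _ _ augmentation
  augmentation_is_linear.

Lemma augmentation_d u : augmentation (u *m fr_d F 0) = 0.
Proof. by apply/fr_exact_0; exists u. Qed.

Lemma fr_dd t (u : 'rV[S]_(fr_rank F t.+2)) : u *m fr_d F t.+1 *m fr_d F t = 0.
Proof. by apply/fr_exact_S; exists u. Qed.

Definition face_deg (T : seq bool) : nat := (\sum_(l < s) nth false T l * z l)%N.

(** A face counts with the degree of the product of its variables. *)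
Definition homogeneous_chain t j (c : seq bool -> 'rV[S]_(fr_rank F t)) :=
  forall T a m, size T = s -> m \in msupp (c T 0 a) ->
    (mwdeg z m + fr_deg a + face_deg T = j)%N.

Lemma size_X : size X = s.
Proof. by rewrite size_map size_enum_ord. Qed.

Lemma nth_X (l : 'I_s) : X`_l = 'X_l.
Proof. by rewrite (nth_map l) ?size_enum_ord // nth_ord_enum. Qed.

Lemma face_deg_add T (l : 'I_s) : nth false T l = false ->
  face_deg (set_nth false T l true) = (z l + face_deg T)%N.
Proof.
move=> Tl; rewrite /face_deg (bigD1 l) //= [in RHS](bigD1 l) //= Tl.
rewrite nth_set_nth /= eqxx mul1n mul0n add0n; congr (_ + _)%N.
by apply: eq_bigr => i il; rewrite nth_set_nth /= val_eqE (negPf il).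
Qed.

Lemma homogeneous_koszul_d t j (c : seq bool -> 'rV[S]_(fr_rank F t)) :
  homogeneous_chain j c -> homogeneous_chain j (kd c).
Proof.
move=> hc T a m sT; move: a m.
apply: (koszul_d_ind (Q := fun x : 'rV[S]_(fr_rank F t) => forall a m,
  m \in msupp (x 0 a) -> (mwdeg z m + fr_deg a + face_deg T = j)%N)).
- by move=> a m; rewrite mxE mcoeff_msupp mcoeff0 eqxx.
- by move=> x y hx hy a m; rewrite mxE => /mem_msuppD/orP[/hx|/hy].
- by move=> x hx a m; rewrite mxE mem_msuppN => /hx.
- by rewrite size_X.
move=> l'; rewrite size_X => ls; pose l := Ordinal ls; rewrite -[l']/(val l).
move=> Tl a m; rewrite nth_X mxE => /mem_msuppM[m1 [m2 [h1 h2 ->]]].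
move: h1; rewrite msuppX inE => /eqP ->.
rewrite -(hc _ _ _ _ h2) ?face_deg_add // ?size_set_nth ?sT; last exact/maxn_idPr.
rewrite mwdegD.
have -> : mwdeg z U_(l)%MM = z l.
  rewrite /mwdeg (bigD1 l) //= mnm1E eqxx mul1n big1 ?addn0 // => i il.
  by rewrite mnm1E eq_sym (negPf il).
lia.
Qed.

Lemma count_add_vertex T l : nth false T l = false ->
  count id (set_nth false T l true) = (count id T).+1.
Proof.
elim: T l => [|b T IH] [|l] //=; first by move=> _; elim: l.
  by move=> ->.
by move/IH => ->; rewrite addnS.
Qed.

Lemma koszul_d_count t p (c : seq bool -> 'rV[S]_(fr_rank F t)) :
  (forall T, size T = s -> count id T != p.+1 -> c T = 0) ->
  forall T, size T = s -> count id T != p -> kd c T = 0.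
Proof.
move=> hc T sT nT; apply: koszul_d_eq0; rewrite ?size_X // => l.
move=> ls Tl; rewrite hc ?scaler0 // ?count_add_vertex //.
by rewrite size_set_nth sT; apply/maxn_idPr.
Qed.

(** The condition on a chain with coefficients in step t of the resolution that
    makes its Koszul differential liftable to step t + 1. *)
Definition linked t : (seq bool -> 'rV[S]_(fr_rank F t)) -> Prop :=
  match t return (seq bool -> 'rV[S]_(fr_rank F t)) -> Prop with
  | 0 => fun c => forall T, size T = s -> augmentation (kd c T) = 0
  | t'.+1 => fun c => exists b, forall T, size T = s -> c T *m fr_d F t' = kd b T
  end.

Lemma koszul_d_mulmx p q (D : 'M[S]_(p, q)) (c : seq bool -> 'rV[S]_p) T :
  kd (fun U => c U *m D) T = kd c T *m D.
Proof. exact: (koszul_d_linear (mulmxr D)). Qed.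

Lemma linked_lift t c : linked c -> forall T, size T = s ->
  exists u : 'rV_(fr_rank F t.+1), kd c T = u *m fr_d F t.
Proof.
case: t c => [|t] c /= hc T sT; first by apply/fr_exact_0/hc.
apply/fr_exact_S; have [b hb] := hc; rewrite -koszul_d_mulmx.
have -> : kd (fun U => c U *m fr_d F t) T = kd (kd b) T.
  by apply: eq_koszul_d; rewrite size_X.
exact: koszul_dd.
Qed.

(** The boundaries of the total complex of the double complex, as far as they are
    seen in a single bidegree. *)
Definition total_boundary t (c : seq bool -> 'rV[S]_(fr_rank F t)) :=
  exists u v, forall T, size T = s -> c T = u T *m fr_d F t + kd v T.

Lemma size_nil_face T : size T = s -> ~~ has id T -> T = nseq s false.
Proof.
move=> <-; elim: T => [|[] T IH] //= h; congr (_ :: _); exact: IH.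
Qed.

Lemma in_var_ideal_full (p : S) :
  p@_0%MM = 0 -> in_var_ideal (enum 'I_s) p.
Proof.
move=> p0 m mp; apply/negPn/negP => /hasPn h.
have m0 : m = 0%MM.
  by apply/mnmP => i; rewrite mnm0E; apply/eqP/negPn/h; rewrite mem_enum.
by rewrite m0 mcoeff_msupp p0 eqxx in mp.
Qed.

Lemma mcoeff0_koszul_d p (c : seq bool -> 'rV[S]_p) T : size T = s ->
  map_mx (mcoeff 0%MM) (kd c T) = 0.
Proof.
move=> sT; apply: (koszul_d_ind
  (Q := fun x : 'rV[S]_p => map_mx (mcoeff 0%MM) x = 0)) => //.
- by rewrite map_mx0.
- by move=> x y hx hy; rewrite map_mxD hx hy addr0.
- by move=> x hx; rewrite map_mxN hx oppr0.
- by rewrite size_X.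
move=> l'; rewrite size_X => ls; pose l := Ordinal ls; rewrite -[l']/(val l) => _.
apply/rowP => a; rewrite !mxE nth_X mcoeff_mulX lep1mP mnm0E //.
Qed.

(** At the end of the chase the chain is an element x of a free module of the
    resolution, at the empty face.  Its reduction modulo the variables is a cycle of
    degree j, hence a boundary w; lifting w to constants W leaves x - W d in the
    ideal of the variables, which is the image of the Koszul differential. *)
Lemma total_boundary_base t j (c : seq bool -> 'rV[S]_(fr_rank F t)) :
  (forall T, size T = s -> count id T != 0%N -> c T = 0) ->
  homogeneous_chain j c -> linked c -> tor_dim F t j = 0%N ->
  total_boundary c.
Proof.
move=> hc hj hl tor0; pose o := nseq s false; pose x := c o.
have so : size o = s by rewrite size_nseq.
pose x0 : 'rV[k]_(fr_rank F t) := map_mx (mcoeff 0%MM) x.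
have x0c : (x0 <= fr_cycles F t)%MS.
  rewrite {}/x0 {}/x; case: t c hl {hc hj tor0} => [|t] c /= hl.
    exact: submx1.
  apply/sub_kermxP; have [b hb] := hl.
  by rewrite -map_mxM hb // mcoeff0_koszul_d.
have x0p : (x0 <= fr_piece F t j)%MS.
  apply/submxP; exists x0; apply/rowP => a; rewrite mul_mx_diag !mxE.
  have [_|na] := eqVneq (fr_deg a) j; first by rewrite mulr1.
  rewrite mulr0; apply/eqP; rewrite mcoeff_eq0; apply: contra na.
  move/(hj _ _ _ so); rewrite mwdeg0 add0n [face_deg _]big1 ?addn0; first by move->.
  by move=> i _; rewrite nth_nseq if_same.
have dc : (fr_dk F t <= fr_cycles F t)%MS.
  case: (t) => [|t'] /=; first exact: submx1.
  apply/sub_kermxP; rewrite -map_mxM; apply/matrixP => a b.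
  rewrite [in RHS]mxE; have := fr_dd (delta_mx 0 a : 'rV_(fr_rank F t'.+2)).
  rewrite -mulmxA -rowE => /rowP/(_ b); rewrite !mxE => ->.
  exact: raddf0.
have /andP[_ le] : (fr_dk F t :&: fr_piece F t j <= fr_cycles F t :&: fr_piece F t j)%MS
   && (fr_cycles F t :&: fr_piece F t j <= fr_dk F t :&: fr_piece F t j)%MS.
  have sub : (fr_dk F t :&: fr_piece F t j <= fr_cycles F t :&: fr_piece F t j)%MS.
    exact: capmxS.
  rewrite sub -(geq_leqif (mxrank_leqif_sup sub)) /=.
  by move/eqP: tor0; rewrite subn_eq0.
have /submxP[w xw] : (x0 <= fr_dk F t)%MS.
  apply: submx_trans (capmxSl _ (fr_piece F t j)); apply: submx_trans le.
  by rewrite sub_capmx x0c.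
pose W : 'rV[S]_(fr_rank F t.+1) := map_mx (@mpolyC s k) w.
pose y T := if has id T then 0 else x - W *m fr_d F t.
have [||e he] := koszul_acyclic_row (c := y) (enum_uniq 'I_s).
- move=> T sT; apply: koszul_d_const; first by move=> U; rewrite /y => ->.
  by rewrite size_map.
- move=> a; rewrite size_enum_ord /y has_nseq andbF; apply: in_var_ideal_full.
  have := congr1 (fun r : 'rV[k]_(fr_rank F t) => r 0 a) xw; rewrite !mxE => E.
  rewrite mcoeffB E raddf_sum -sumrB; apply: big1 => b _ /=.
  by rewrite !mxE mul_mpolyC mcoeffZ subrr.
exists (fun T => if has id T then 0 else W), e => T sT.
rewrite he ?size_enum_ord // /y; case: ifPn => hT.
  by rewrite mul0mx addr0 hc // -lt0n -has_count.
by rewrite addrC subrK (size_nil_face sT hT).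
Qed.

(** One step of the chase: the Koszul differential of c is lifted to a chain c' in
    the next free module, with faces of one element less.  If c' is a total boundary
    then c can be corrected to a Koszul cycle, and Koszul exactness applies. *)
Lemma total_boundary_step p : forall t j (c : seq bool -> 'rV[S]_(fr_rank F t)),
  (forall T, size T = s -> count id T != p -> c T = 0) ->
  homogeneous_chain j c -> linked c -> tor_dim F (p + t) j = 0%N ->
  total_boundary c.
Proof.
elim: p => [|p IH] t j c hc hj hl tor0; first exact: total_boundary_base hl tor0.
have ex T : exists u : 'rV[S]_(fr_rank F t.+1), size T = s ->
    [/\ kd c T = u *m fr_d F t, count id T != p -> u = 0
      & forall a m, m \in msupp (u 0 a) ->
          (mwdeg z m + fr_deg a + face_deg T = j)%N].
  have [sT|sT] := eqVneq (size T) s; last by exists 0 => E; rewrite E eqxx in sT.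
  have [cT|cT] := eqVneq (count id T) p; last first.
    exists 0; split => //; first by rewrite mul0mx (koszul_d_count hc).
    by move=> a m; rewrite mxE mcoeff_msupp mcoeff0 eqxx.
  have [u uE] := linked_lift hl sT.
  have hd b m : m \in msupp (kd c T 0 b) ->
      (mwdeg z m + fr_deg b = j - face_deg T)%N.
    by move/(homogeneous_koszul_d hj sT) <-; rewrite addnK.
  have [Tj|Tj] := leqP (face_deg T) j; last first.
    exists 0; split=> //; last by move=> a m; rewrite mxE mcoeff_msupp mcoeff0 eqxx.
    rewrite mul0mx; apply/rowP => b; rewrite mxE; apply/eqP; rewrite -msupp_eq0.
    case E : (msupp _) => [//|m l]; have : m \in msupp (kd c T 0 b).
      by rewrite E mem_head.
    by move/(homogeneous_koszul_d hj sT); lia.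
  exists (row_part z (@fr_deg _ _ _ _ _ F t.+1) (j - face_deg T) u); split.
  - rewrite -(row_part_mulmx _ _ (@fr_d_homog _ _ _ _ _ F t)) -uE.
    by rewrite row_part_id.
  - by case/eqP.
  - by move=> a m /row_partP ->; rewrite subnK.
pose c' T := proj1_sig (constructive_indefinite_description _ (ex T)).
have hc' T : size T = s ->
    [/\ kd c T = c' T *m fr_d F t, count id T != p -> c' T = 0
      & forall a m, m \in msupp (c' T 0 a) ->
          (mwdeg z m + fr_deg a + face_deg T = j)%N].
  by rewrite /c'; case: constructive_indefinite_description.
have [||||u [v uv]] := IH t.+1 j c'.
- by move=> T sT; case: (hc' T sT).
- by move=> T a m sT; case: (hc' T sT) => _ _; apply.
- by exists c => T sT; case: (hc' T sT).
- by rewrite addnS.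
(* Koszul exactness requires a chain that vanishes at the empty face. *)
pose v' T := if has id T then v T else 0.
have dv T : size T = s -> kd v' T = kd v T.
  move=> sT; apply/eqP; rewrite -subr_eq0 -koszul_dN -koszul_dD; apply/eqP.
  by apply: koszul_d_const; rewrite ?size_X // /v' => U ->; rewrite subrr.
have [||e he] := koszul_acyclic_row (c := fun T => c T - v' T *m fr_d F t)
  (enum_uniq 'I_s).
- move=> T; rewrite size_enum_ord => sT; rewrite koszul_dD koszul_dN koszul_d_mulmx.
  have [-> _ _] := hc' T sT; rewrite dv // uv // mulmxDl fr_dd add0r subrr //.
- move=> a; rewrite size_enum_ord hc ?size_nseq // ?count_nseq ?mul0n //.
  by rewrite /v' has_nseq andbF mul0mx subr0 mxE; apply: in_var_ideal0.
exists v', e => T sT; rewrite he ?size_enum_ord // addrC subrK //.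
Qed.

(** Balancing of Tor, in the one direction that is needed and on explicit chains: the
    descent through the resolution by [total_boundary_step], pushed back to M by the
    augmentation. *)
Theorem koszul_boundary_of_tor_dim i j (c : seq bool -> 'rV[S]_(fr_rank F 0)) :
  (forall T, size T = s -> count id T != i -> c T = 0) ->
  homogeneous_chain j c ->
  (forall T, size T = s -> kd (fun U => augmentation (c U)) T = 0) ->
  tor_dim F i j = 0%N ->
  exists e, forall T, size T = s -> augmentation (c T) = kd e T.
Proof.
move=> hc hj hl tor0; rewrite -[i]addn0 in tor0.
have [|u [v uv]] := total_boundary_step hc hj _ tor0.
  by move=> T sT /=; rewrite -koszul_d_linear hl.
exists (fun T => augmentation (v T)) => T sT.
by rewrite uv // raddfD /= augmentation_d add0r koszul_d_linear.
Qed.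

End Balance.

(** * The Hilbert basis theorem *)

(** Dickson's lemma by induction on the number n of coordinates that are compared:
    below the maximum B of coordinate n on a basis for n coordinates there are only
    finitely many slices, and above it that basis suffices. *)
Lemma dickson_aux s (n : nat) (A : 'X_{1..s} -> Prop) :
  exists L : seq 'X_{1..s}, (forall l, l \in L -> A l) /\
    forall a, A a -> exists2 l, l \in L &
      forall i : 'I_s, (i < n)%N -> (l i <= a i)%N.
Proof.
elim: n A => [|n IH] A.
  case: (excluded_middle_informative (exists a, A a)) => [[a Aa]|nA].
    exists [:: a]; split=> [l|b _]; first by rewrite inE => /eqP->.
    by exists a; rewrite ?mem_head.
  by exists [::]; split=> // a Aa; case: nA; exists a.
have [ns|sn] := ltnP n s; last first.
  have [L [LA hL]] := IH A; exists L; split=> // a /hL[l lL hl]; exists l => // i _.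
  by apply: hl; apply: leq_trans sn.
pose i0 := Ordinal ns; have [L1 [L1A hL1]] := IH A.
pose B := \max_(l <- L1) l i0.
have /fin_all_exists [L2 hL2] (v : 'I_B) := IH (fun a => A a /\ a i0 = v :> nat).
exists (L1 ++ flatten [seq L2 v | v <- enum 'I_B]); split=> [l|a Aa].
  rewrite mem_cat => /orP[/L1A//|/flatten_mapP[v _ lv]].
  by have [h _] := hL2 v; case: (h l lv).
have leE (l : 'X_{1..s}) : (forall i : 'I_s, (i < n)%N -> (l i <= a i)%N) ->
    (l i0 <= a i0)%N -> forall i : 'I_s, (i < n.+1)%N -> (l i <= a i)%N.
  move=> h h0 i; rewrite ltnS leq_eqVlt => /orP[/eqP E|/h//].
  by have -> : i = i0 by apply: val_inj.
have [aB|Ba] := ltnP (a i0) B.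
  have [_ /(_ a)[//|l lL hl]] := hL2 (Ordinal aB).
  have [_ li0] := (hL2 (Ordinal aB)).1 l lL.
  exists l; last by apply: leE => //; rewrite li0.
  by rewrite mem_cat; apply/orP; right; apply/flatten_mapP; exists (Ordinal aB);
     rewrite ?mem_enum.
have [l lL hl] := hL1 a Aa; exists l; first by rewrite mem_cat lL.
by apply: leE => //; apply: leq_trans Ba; rewrite /B (big_rem l) //= leq_maxl.
Qed.

Lemma dickson s (A : 'X_{1..s} -> Prop) :
  exists L : seq 'X_{1..s}, (forall l, l \in L -> A l) /\
    forall a, A a -> exists2 l, l \in L & (l <= a)%MM.
Proof.
have [L [LA hL]] := dickson_aux s A; exists L; split=> // a /hL[l lL hl].
by exists l => //; apply/mnm_lepP => i; apply: hl.
Qed.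

Section Noetherian.
Variables (k : fieldType) (s : nat).
Local Notation S := {mpoly k[s]}.

(** Elements whose leading monomials generate the leading monomials generate the
    ideal: division terminates because the monomial order is well-founded. *)
Theorem hilbert_basis (I : S -> Prop) :
  (forall f g, I f -> I g -> I (f + g)) -> (forall a f, I f -> I (a * f)) ->
  exists r (g : 'I_r -> S), (forall i, I (g i)) /\
    forall f, I f -> exists a : 'I_r -> S, f = \sum_i a i * g i.
Proof.
move=> ID IM.
have [L [LA hL]] := dickson (fun m => exists f, [/\ I f, f != 0 & mlead f = m]).
have /fin_all_exists [g hg] (i : 'I_(size L)) :
    exists f, [/\ I f, f != 0 & mlead f = nth 0%MM L i].
  by apply: LA; apply: mem_nth.
exists (size L), g; split=> [i|]; first by case: (hg i).
suff H m : forall f, mlead f = m -> I f -> exists a : 'I_(size L) -> S, f = \sum_i a i * g i.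
  by move=> f; apply: H.
elim/(@ltmwf s): m => m IH f fm If.
have [f0|f0] := eqVneq f 0.
  by exists (fun=> 0); rewrite f0 big1 // => i _; rewrite mul0r.
have [|l /(nthP 0%MM)[i0 iL <-{l}] le] := hL m; first by exists f.
pose i := Ordinal iL; have [Ig g0 gi] := hg i; rewrite -[i0]/(val i) -gi in le.
pose c : S := (mleadc f / mleadc (g i)) *: 'X_[(m - mlead (g i))%MM].
pose f' := f + - c * g i.
have If' : I f' by apply: ID => //; apply: IM.
have [fa] : exists a : 'I_(size L) -> S, f' = \sum_i a i * g i.
  have [f'0|f'0] := eqVneq f' 0.
    by exists (fun=> 0); rewrite f'0 big1 // => j _; rewrite mul0r.
  apply: (IH (mlead f')) => //.
  have cg : c * g i = (mleadc f / mleadc (g i)) *: ('X_[(m - mlead (g i))%MM] * g i).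
    by rewrite -scalerAl.
  have leadX : mlead ('X_[(m - mlead (g i))%MM] * g i) = m.
    by rewrite mleadM ?mleadXm ?submK // -msupp_eq0 msuppX.
  rewrite lt_neqAle; apply/andP; split.
    apply: contraTneq (mlead_supp f'0) => ->.
    rewrite mcoeff_msupp negbK mcoeffD mulNr mcoeffN cg mcoeffZ.
    rewrite mcoeff_mulX lem_subr submBA // addmC addmK -fm.
    by rewrite divfK ?subrr // mleadc_eq0.
  rewrite /f' mulNr; apply: (le_trans (mleadB_le _ _)).
  rewrite leUx fm lexx /= cg.
  by apply: (le_trans (mleadZ_le _ _)); rewrite leadX.
move=> f'E; exists (fun j => fa j + (if j == i then c else 0)).
rewrite (eq_bigr (fun j => fa j * g j + (if j == i then c else 0) * g j)).
  rewrite big_split /= -f'E [X in _ + X](bigD1 i) //= eqxx big1 ?addr0.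
    by rewrite /f' mulNr subrK.
  by move=> j /negPf->; rewrite mul0r.
by move=> j _; rewrite mulrDl.
Qed.

Definition submodule p (N : 'rV[S]_p -> Prop) : Prop :=
  [/\ N 0, forall u v, N u -> N v -> N (u + v) & forall a u, N u -> N (a *: u)].

Lemma submodule_mulmx p r (N : 'rV[S]_p -> Prop) (E : 'M[S]_(r, p)) u :
  submodule N -> (forall i, N (row i E)) -> N (u *m E).
Proof.
move=> [N0 ND NZ] NE; rewrite mulmx_sum_row.
by elim/big_ind: _ => // i _; apply: NZ.
Qed.

(** Induction on the rank: the first coordinates form an ideal, and the elements
    with first coordinate zero form a submodule of smaller rank. *)
Theorem noetherian_rows p (N : 'rV[S]_p -> Prop) : submodule N ->
  exists r (E : 'M[S]_(r, p)), forall v, N v <-> exists u, v = u *m E.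
Proof.
elim: p N => [|p IH]; last rewrite -[p.+1]/(1 + p)%N; move=> N NS.
  exists 0%N, 0 => v; split=> _; first by exists 0; apply/rowP => -[].
  by have [N0 _ _] := NS; rewrite (_ : v = 0) //; apply/rowP => -[].
have [N0 ND NZ] := NS.
have [||r [g [Ng hg]]] := @hilbert_basis (fun f => exists2 v, N v & v 0 (lshift p 0) = f).
- move=> f1 f2 [v1 n1 <-] [v2 n2 <-]; exists (v1 + v2); first exact: ND.
  by rewrite mxE.
- by move=> a f [v n <-]; exists (a *: v); [apply: NZ | rewrite mxE].
have /fin_all_exists2 [w Nw wg] := Ng.
pose N' (v : 'rV[S]_p) := N (row_mx (0 : 'rV_1) v : 'rV_(1 + p)).
have [|r' [E' hE']] := IH N'.
  split.
  - by rewrite /N' row_mx0.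
  - by move=> u v nu nv; rewrite /N' -[0]addr0 -add_row_mx; apply: ND.
  - by move=> a u nu; rewrite /N' -[0](scaler0 _ a) -scale_row_mx; apply: NZ.
pose W : 'M[S]_(r, 1 + p) := \matrix_i w i.
exists (r + r')%N, (col_mx W (row_mx (0 : 'M_(_, 1)) E')) => v; split=> [Nv|[u ->]].
  have [a ha] := hg _ (ex_intro2 _ _ v Nv erefl).
  pose u1 : 'rV[S]_r := \row_i a i.
  pose v' : 'rV[S]_(1 + p) := v - u1 *m W.
  have Nv' : N v'.
    apply: ND => //; rewrite -scaleN1r; apply: NZ; apply: submodule_mulmx => // i.
    by rewrite rowK.
  have v'E : v' = row_mx 0 (rsubmx v').
    rewrite -[LHS]hsubmxK; congr row_mx; apply/rowP => j; rewrite ord1 !mxE.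
    by rewrite ha -sumrB big1 // => i _; rewrite !mxE wg subrr.
  have [u2 hu2] : exists u, rsubmx v' = u *m E' by apply/hE'; rewrite /N' -v'E.
  exists (row_mx u1 u2); rewrite mul_row_col mul_mx_row mulmx0 -hu2 -v'E.
  by rewrite /v' addrC subrK.
apply: submodule_mulmx => // i; rewrite -[i]splitK; case: (split i) => j /=.
  by rewrite rowKu rowK.
rewrite rowKd row_row_mx row0; apply/hE'.
by exists (delta_mx 0 j); rewrite -rowE.
Qed.

End Noetherian.

(** * Existence of graded free resolutions *)

Section Resolution.
Variables (k : fieldType) (s : nat) (z : 'I_s -> nat).
Local Notation S := {mpoly k[s]}.

Definition graded_submodule p (dg : 'I_p -> nat) (N : 'rV[S]_p -> Prop) : Prop :=
  submodule N /\ forall e v, N v -> N (row_part z dg e v).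

(** The homogeneous parts of finitely many generators are finitely many, belong to
    the submodule, and generate it. *)
Lemma graded_generators p (dg : 'I_p -> nat) (N : 'rV[S]_p -> Prop) :
  graded_submodule dg N ->
  exists r (dg' : 'I_r -> nat) (E : 'M[S]_(r, p)),
    (forall a b m, m \in msupp (E a b) -> (mwdeg z m + dg b = dg' a)%N) /\
    forall v, N v <-> exists u, v = u *m E.
Proof.
case=> NS NG; have [r [E hE]] := noetherian_rows NS.
pose B := \max_i \max_b \max_(m <- msupp (E i b)) (mwdeg z m + dg b).+1.
have hB i b m : m \in msupp (E i b) -> (mwdeg z m + dg b < B)%N.
  move=> mE; rewrite /B; apply: leq_trans (leq_bigmax i).
  apply: leq_trans (leq_bigmax b).
  by rewrite (big_rem m) //= leq_maxl.
pose J : finType := ('I_r * 'I_B)%type.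
pose E' := \matrix_(x < #|{: J}|) row_part z dg (enum_val x).2 (row (enum_val x).1 E).
have rowsum i : row i E = \sum_(e < B) row_part z dg e (row i E).
  apply/rowP => b; rewrite summxE; apply/mpolyP => m; rewrite raddf_sum /=.
  rewrite (eq_bigr (fun e : 'I_B => if (mwdeg z m + dg b == e)%N
                                    then (row i E 0 b)@_m else 0)); last first.
    by move=> e _; rewrite mxE mcoeff_mfilter.
  have [mE|mE] := boolP (m \in msupp (row i E 0 b)); last first.
    by rewrite (memN_msupp_eq0 mE) big1 // => e _; rewrite if_same.
  rewrite mxE in mE; rewrite (bigD1 (Ordinal (hB _ _ _ mE))) //= eqxx big1 ?addr0 //.
  by move=> e; rewrite eq_sym -val_eqE /= => /negPf->.
have NE i : N (row i E) by apply/hE; exists (delta_mx 0 i); rewrite rowE.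
pose dg' (x : 'I_#|{: J}|) : nat := (enum_val x).2.
exists #|{: J}|. exists dg'. exists E'. split=> [a b m|v].
  by rewrite mxE; apply: row_partP.
split=> [/hE[u ->]|[u ->]]; last first.
  by apply: submodule_mulmx => // x; rewrite rowK; apply: NG.
exists (\row_x u 0 (enum_val x).1); rewrite !mulmx_sum_row.
rewrite (eq_bigr (fun i => \sum_(e < B) u 0 i *: row_part z dg e (row i E))).
  rewrite pair_bigA /= [RHS](eq_bigr (fun x : 'I_#|{: J}| =>
    u 0 (enum_val x).1 *: row_part z dg (enum_val x).2 (row (enum_val x).1 E))).
    by rewrite -(big_enum_val (A := {: J})
      (fun y : J => u 0 y.1 *: row_part z dg y.2 (row y.1 E))).
  by move=> x _; rewrite rowK mxE.
by move=> i _; rewrite {1}rowsum scaler_sumr.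
Qed.

Lemma graded_kernel p q (dg : 'I_p -> nat) (dg' : 'I_q -> nat) (D : 'M[S]_(p, q)) :
  (forall a b m, m \in msupp (D a b) -> (mwdeg z m + dg' b = dg a)%N) ->
  graded_submodule dg (fun v => v *m D = 0).
Proof.
move=> hD; split; first split.
- by rewrite mul0mx.
- by move=> u v hu hv; rewrite mulmxDl hu hv addr0.
- by move=> a u hu; rewrite -scalemxAl hu scaler0.
move=> e v hv; rewrite -(row_part_mulmx _ _ hD) hv; apply/rowP => b; rewrite !mxE.
by apply: mfilter_eq0 => m; rewrite mcoeff_msupp mcoeff0 eqxx.
Qed.

(** The state of the construction of a resolution: the module of which generators
    have to be chosen next. *)
Record stage := Stage {
  st_rank : nat;
  st_deg : 'I_st_rank -> nat;
  st_mod : 'rV[S]_st_rank -> Prop;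
  st_graded : graded_submodule st_deg st_mod }.

(** Chosen in Type, so that the ranks and the matrices of the resolution can be
    projected from one choice and have matching dimensions by conversion. *)
Definition cover (X : stage) : Type :=
  { r : nat & { dg' : 'I_r -> nat & { E : 'M[S]_(r, st_rank X) |
    (forall a b m, m \in msupp (E a b) -> (mwdeg z m + st_deg b = dg' a)%N) /\
    forall v, st_mod v <-> exists u, v = u *m E } } }.

Lemma cover_exists (X : stage) : inhabited (cover X).
Proof.
have [r [dg' [E hE]]] := graded_generators (st_graded X).
by constructor; exists r, dg', E.
Qed.

Definition the_cover (X : stage) : cover X := epsilon (cover_exists X) (fun=> True).

Definition syzygies (X : stage) : stage :=
  let C := the_cover X in
  Stage (graded_kernel (proj1 (proj2_sig (projT2 (projT2 C))))).

Fixpoint iter_syzygies (X : stage) (n : nat) : stage :=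
  if n is n'.+1 then syzygies (iter_syzygies X n') else X.

(** For a cyclic module the first syzygies form an ideal, and the last hypothesis says
    that it is graded.  All later syzygies are kernels of homogeneous matrices, which
    are graded automatically. *)
Theorem resolution_exists (M : lmodType S) (Mdeg : nat -> {pred M}) (x0 : M) :
  x0 \in Mdeg 0%N -> (forall x, exists f, x = f *: x0) ->
  (forall e f, f *: x0 = 0 -> mfilter (fun m => mwdeg z m == e) f *: x0 = 0) ->
  inhabited (graded_free_resolution z Mdeg).
Proof.
move=> x0M gen ann.
have gr : graded_submodule (fun=> 0%N) (fun v : 'rV[S]_1 => v 0 0 *: x0 = 0).
  split; first split.
  - by rewrite mxE scale0r.
  - by move=> u v hu hv; rewrite mxE scalerDl hu hv addr0.
  - by move=> a u hu; rewrite mxE -scalerA hu scaler0.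
  move=> e v /(ann e) hv; rewrite mxE -[RHS]hv; congr (_ *: _).
  by apply/mpolyP => m; rewrite !mcoeff_mfilter addn0.
pose St := iter_syzygies (Stage gr).
pose C i := the_cover (St i).
pose D i : 'M[S]_(st_rank (St i.+1), st_rank (St i)) :=
  proj1_sig (projT2 (projT2 (C i))).
have DP i : (forall a b m, m \in msupp (D i a b) ->
      (mwdeg z m + st_deg b = @st_deg (St i.+1) a)%N) /\
    forall v, @st_mod (St i) v <-> exists u, v = u *m D i.
  exact: (proj2_sig (projT2 (projT2 (C i)))).
constructor; apply: (@GradedFreeResolution _ _ _ _ _ (fun i => st_rank (St i))
  (fun i => @st_deg (St i)) (fun=> x0) D).
- by [].
- by move=> i; have [] := DP i.
- move=> x; have [f ->] := gen x; exists (const_mx f).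
  by rewrite big_ord1 mxE.
- by move=> v; rewrite big_ord1; have [_ h] := DP 0%N; apply: h.
- by move=> i v; have [_ h] := DP i.+1; apply: h.
Qed.

End Resolution.

(** * The Veronese ring as a graded module *)

Section FaceMonomials.
Variables (k : fieldType) (r : nat).

(** The product of the generators in a face, by the recursion of [koszul_d]. *)
Fixpoint face_mon (L : seq 'X_{1..r}) (T : seq bool) : 'X_{1..r} :=
  match L, T with
  | u :: L', b :: T' => ((if b then u else 0) + face_mon L' T')%MM
  | _, _ => 0%MM
  end.

Lemma face_monE L T c : size T = size L ->
  face_mon L T c = (\sum_(i < size L) nth false T i * nth 0%MM L i c)%N.
Proof.
elim: L T => [|u L IH] [|b T] //=; first by rewrite big_ord0 mnm0E.
move=> [sT]; rewrite big_ord_recl mnmDE IH //=; congr (_ + _)%N.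
by case: b; rewrite ?mul1n ?mnm0E.
Qed.

(** In the multidegree b, the Koszul complex of monomials is the simplicial chain
    complex of the faces whose product divides b: the monomial at a face is
    determined, and the differential acts on the scalars alone. *)
Lemma koszul_d_monomial (L : seq 'X_{1..r}) (f : seq bool -> k^o) b :
  (forall T, size T = size L -> f T != 0 -> (face_mon L T <= b)%MM) ->
  forall T, size T = size L ->
  koszul_d (M := {mpoly k[r]}^o) [seq 'X_[u] | u <- L]
    (fun U => f U *: 'X_[b - face_mon L U] : {mpoly k[r]}) T
  = (koszul_d (M := k^o) (nseq (size L) 1) f T : k) *: 'X_[b - face_mon L T].
Proof.
elim: L f b => [|u L IH] f b hf [|a T] //=; first by rewrite scale0r.
move=> [sT]; case: a.
  rewrite scaleNr; congr (- _).
  have -> : (b - (u + face_mon L T) = b - u - face_mon L T)%MM by rewrite submDA.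
  rewrite -IH //; last first.
    move=> U sU fU; have := hf (true :: U); rewrite /= sU => /(_ erefl fU).
    move/mnm_lepP => h; apply/mnm_lepP => i; have := h i.
    by rewrite mnmBE mnmDE; lia.
  apply: (eq_koszul_d (M := {mpoly k[r]}^o)); rewrite ?size_map //.
  by move=> U _; rewrite submDA.
rewrite add0m scalerDl -IH //; last first.
  by move=> U sU fU; have := hf (false :: U); rewrite /= sU add0m => /(_ erefl fU).
congr (_ + _).
  apply: (eq_koszul_d (M := {mpoly k[r]}^o)); rewrite ?size_map //.
  by move=> U _; rewrite add0m.
rewrite -[LHS]/('X_[u] * (f (true :: T) *: 'X_[_])) -scalerAr -mpolyXD.
rewrite -[1 *: f (true :: T)]/(1 * f (true :: T)) mul1r.
have [->|fT] := eqVneq (f (true :: T)) 0; first by rewrite !scale0r.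
congr (_ *: 'X_[_]); have := hf (true :: T); rewrite /= sT => /(_ erefl fT).
move/mnm_lepP => h; apply/mnmP => i; have := h i.
by rewrite !(mnmBE, mnmDE); lia.
Qed.

End FaceMonomials.

Section VeroneseModule.
Variables (k : fieldType) (r : nat) (w : 'I_r -> nat) (d : nat).
Variables (s : nat) (z : 'I_s -> nat).
Variable phi : {lrmorphism {mpoly k[s]} -> veronese k w d}.
Variable mon : 'I_s -> 'X_{1..r}.
Hypothesis phiX : forall i, veronese_val (phi 'X_i) = 'X_[mon i].
Hypothesis mon_deg : forall i, mwdeg w (mon i) = (d * z i)%N.

Local Notation S := {mpoly k[s]}.
Local Notation val := (@veronese_val k r w d).
Local Notation X := [seq 'X_l : S | l <- enum 'I_s].

Lemma veronese_inj : injective val. Proof. exact: val_inj. Qed.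
Lemma valD x y : val (x + y) = val x + val y. Proof. by []. Qed.
Lemma valN x : val (- x) = - val x. Proof. by []. Qed.
Lemma val_sum I (e : seq I) f : val (\sum_(i <- e) f i) = \sum_(i <- e) val (f i).
Proof. exact: (big_morph val valD). Qed.
Lemma val_prod I (e : seq I) f : val (\prod_(i <- e) f i) = \prod_(i <- e) val (f i).
Proof. exact: (big_morph val (fun x y => erefl)). Qed.
Lemma val_exp x n : val (x ^+ n) = val x ^+ n.
Proof. by elim: n => [//|n IH]; rewrite !exprS -IH. Qed.

(** The homomorphism of monoids induced by phi on monomials. *)
Definition mon_prod (m : 'X_{1..s}) : 'X_{1..r} := (\sum_i mon i *+ m i)%MM.

Lemma val_phiX m : val (phi 'X_[m]) = 'X_[mon_prod m].
Proof.
rewrite mpolyXE_id rmorph_prod /= /mon_prod -mprodXE.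
rewrite val_prod.
apply: eq_bigr => i _; by rewrite rmorphXn val_exp phiX mpolyXn.
Qed.

Lemma mwdeg_muln (I : finType) n (u : 'I_n -> nat) (m : I -> 'X_{1..n}) (e : I -> nat) :
  mwdeg u (\sum_i m i *+ e i)%MM = (\sum_i mwdeg u (m i) * e i)%N.
Proof.
rewrite /mwdeg [RHS](eq_bigr (fun i => \sum_(j < n) m i j * u j * e i)%N); last first.
  by move=> i _; rewrite big_distrl.
rewrite exchange_big /=; apply: eq_bigr => j _.
rewrite mnm_sumE big_distrl /=; apply: eq_bigr => i _.
by rewrite mulmnE; lia.
Qed.

Lemma mwdeg_mon_prod m : mwdeg w (mon_prod m) = (d * mwdeg z m)%N.
Proof.
rewrite /mon_prod mwdeg_muln [in RHS]/mwdeg big_distrr /=; apply: eq_bigr => i _.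
by rewrite mon_deg -mulnA [(z i * _)%N]mulnC.
Qed.

Lemma msupp_val_phi (f : S) m : m \in msupp (val (phi f)) ->
  exists2 m', m' \in msupp f & m = mon_prod m'.
Proof.
rewrite {1}[f]mpolyE linear_sum /= val_sum.
rewrite mcoeff_msupp raddf_sum /= => nz.
have [/hasP[m' m'f /eqP mE]|/hasPn h] := boolP (has (fun m' => mon_prod m' == m) (msupp f)).
  by exists m'.
case/eqP: nz; rewrite big_seq big1 // => m' /h /negPf m'm.
rewrite linearZ -[val _]/(f@_m' *: val (phi 'X_[m'])) val_phiX.
by rewrite mcoeffZ mcoeffX m'm mulr0.
Qed.

Lemma val_phiD f g : val (phi (f + g)) = val (phi f) + val (phi g).
Proof. by rewrite rmorphD. Qed.

Hypothesis d_gt0 : (0 < d)%N.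

(** Since phi multiplies degrees by d, selecting a degree commutes with it.  The
    factor h allows shifts of the degree. *)
Lemma phi_filter (f : S) (h : {mpoly k[r]}) (e e' : nat) :
  h \is (d * e').-homog for (mwdeg w) ->
  mfilter (fun m => mwdeg w m == d * e)%N (val (phi f) * h)
  = val (phi (mfilter (fun m => mwdeg z m + e' == e)%N f)) * h.
Proof.
move=> /dhomogP hh; set Q := (fun m => mwdeg z m + e' == e)%N.
rewrite -{1}(mfilterC Q f) val_phiD mulrDl mfilterD.
rewrite mfilter_id => [|m]; last first.
  case/mem_msuppM => [_ [m2 [/msupp_val_phi[m1 + ->] /hh h2 ->]]].
  rewrite msupp_mfilter mwdegD mwdeg_mon_prod h2 -mulnDr eqn_pmul2l //.
  by case/andP.
rewrite [X in _ + X]mfilter_eq0 ?addr0 // => m.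
case/mem_msuppM => [_ [m2 [/msupp_val_phi[m1 + ->] /hh h2 ->]]].
rewrite msupp_mfilter mwdegD mwdeg_mon_prod h2 -mulnDr eqn_pmul2l //.
by case/andP.
Qed.

Local Notation M := (restrict_scalars phi).
Local Notation Mdeg := (@veronese_deg k r w d).

Lemma val_scale (f : S) (x : M) : val (f *: x) = val (phi f) * val x.
Proof. by []. Qed.

Lemma veronese_resolution : (forall x, exists p, phi p = x) ->
  inhabited (graded_free_resolution z (M := M) Mdeg).
Proof.
move=> surj; apply: (resolution_exists (x0 := (1 : veronese k w d) : M)).
- rewrite -[_ \in _]/((1 : {mpoly k[r]}) \is (d * 0).-homog for (mwdeg w)).
  by rewrite muln0; apply: dhomog1.
- by move=> x; have [f fx] := surj x; exists f; apply: veronese_inj; rewrite val_scale mulr1 fx.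
move=> e f f0; apply: veronese_inj; rewrite val_scale.
have /(phi_filter f e) : (1 : {mpoly k[r]}) \is (d * 0).-homog for (mwdeg w).
  by rewrite muln0; apply: dhomog1.
have -> : val (phi f) * 1 = 0 by have := congr1 val f0.
rewrite mfilter_eq0; last by move=> m; rewrite mcoeff_msupp mcoeff0 eqxx.
move=> E; rewrite [RHS]E; congr (val (phi _) * _).
by apply/mpolyP => m; rewrite !mcoeff_mfilter addn0.
Qed.

Variable F : graded_free_resolution z (M := M) Mdeg.

Lemma val_augmentation_part e v :
  val (augmentation (row_part z (@fr_deg _ _ _ _ _ F 0) e v))
  = mfilter (fun m => mwdeg w m == d * e)%N (val (augmentation (F := F) v)).
Proof.
rewrite /augmentation !val_sum mfilter_sum.
apply: eq_bigr => a _; rewrite val_scale mxE (phi_filter _ _ (e' := fr_deg a)) //.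
exact: (fr_aug_homog (g := F)).
Qed.

Lemma val_koszul_d (c : seq bool -> M) T :
  val (koszul_d X c T)
  = koszul_d (M := {mpoly k[r]}^o) [seq 'X_[u] | u <- [seq mon i | i <- enum 'I_s]]
      (fun U => val (c U)) T.
Proof.
elim: (enum 'I_s) c T => [|i L IH] c [|b T] //=.
case: b; first by rewrite valN IH.
rewrite valD IH; congr (_ + _).
by rewrite val_scale phiX.
Qed.

End VeroneseModule.

(** * The cross-polytope cycle *)

(** In this section P is a set of generators and a selects for each j in P a variable
    of R, whose pure power lam (a j) divides m times the generator j. *)

Section CrossPolytope.
Variables (k : fieldType) (s r : nat).
Variables (mon : 'I_s -> 'X_{1..r}) (lam : 'I_r -> 'I_s) (g : 'I_r -> nat).
Variables (m : 'X_{1..r}) (P : {set 'I_s}) (a : 'I_s -> 'I_r).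
Hypothesis mon_lam : forall c, mon (lam c) = (U_(c) *+ g c)%MM.
Hypothesis lamP : forall c, lam c \notin P.
Hypothesis aP : forall j, j \in P -> (g (a j) <= m (a j) + mon j (a j))%N.

(** The vector from lam (a j) to j. *)
Definition edge (j : 'I_s) : seq k :=
  [seq (l == j)%:R - (l == lam (a j))%:R | l <- enum 'I_s].

Definition face_mask (J : seq 'I_s) : seq bool := [seq l \in J | l <- enum 'I_s].

(** The wedge product of the edges, starting from 1 at the empty face.  When the
    vertices lam (a j) are distinct this is the fundamental cycle of the boundary of
    a cross-polytope; in general faces through a repeated vertex cancel. *)
Definition cross_chain (J : seq 'I_s) : seq bool -> k^o :=
  foldr (fun j f => wedge (M := k^o) (edge j) f)
    (fun T => if has id T then 0 else 1) J.

Lemma size_edge j : size (edge j) = s.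
Proof. by rewrite size_map size_enum_ord. Qed.

Lemma size_face_mask J : size (face_mask J) = s.
Proof. by rewrite size_map size_enum_ord. Qed.

Lemma nth_edge j (l : 'I_s) : (edge j)`_l = (l == j)%:R - (l == lam (a j))%:R.
Proof. by rewrite (nth_map l) ?size_enum_ord // nth_ord_enum. Qed.

Lemma nth_face_mask J (l : 'I_s) : nth false (face_mask J) l = (l \in J).
Proof. by rewrite (nth_map l) ?size_enum_ord // nth_ord_enum. Qed.

(** The sum of the coordinates of each edge vanishes, so each factor is a cycle for
    the simplicial differential, and that is a derivation. *)
Lemma cross_cycle J T : size T = s ->
  koszul_d (M := k^o) (nseq s 1) (cross_chain J) T = 0.
Proof.
elim: J T => [|j J IH] T sT /=.
  apply: (koszul_d_eq0 (M := k^o)); rewrite size_nseq // => l ls Tl.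
  case: ifPn; rewrite ?scaler0 // => /negP[].
  by rewrite has_count count_add_vertex.
have := @koszul_d_wedge _ k^o (nseq s 1) (edge j) (cross_chain J) T.
rewrite size_nseq size_edge => /(_ erefl sT).
rewrite [X in _ + X](_ : _ = 0) => [|]; last first.
  apply: (wedge_eq0 (M := k^o)); rewrite size_edge // => l ls Tl.
  by rewrite IH ?scaler0 // size_set_nth sT; apply/maxn_idPr.
rewrite addr0 => ->; rewrite (eq_bigr (fun i => (i == j)%:R - (i == lam (a j))%:R)).
  have sum1 (i0 : 'I_s) : \sum_(i < s) (i == i0)%:R = 1 :> k.
    by rewrite (bigD1 i0) //= eqxx big1 ?addr0 // => i /negPf->.
  by rewrite sumrB !sum1 subrr scale0r.
by move=> i _; rewrite nth_edge nth_nseq ltn_ord mulr1.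
Qed.

Lemma nth_set_false T (l i : nat) : nth false (set_nth false T l false) i ->
  nth false T i.
Proof. by rewrite nth_set_nth /=; case: eqP. Qed.

(** A face in the support is obtained from J by replacing some j by lam (a j), each
    pure power being used at most once.  Such a replacement raises the exponent of
    one variable of R by at most m (a j), and lowers the others; so all these faces
    divide the product of m and J. *)
Lemma cross_support J T : {subset J <= P} -> size T = s -> cross_chain J T != 0 ->
  count id T = size J /\
  forall c, (\sum_(l < s) nth false T l * mon l c
             <= \sum_(j <- J) mon j c + (if nth false T (lam c) then m c else 0))%N.
Proof.
elim: J T => [|j J IH] T JP sT /=.
  case: ifPn => [_|hT _]; first by rewrite eqxx.
  have T0 l : nth false T l = false.
    have [lT|lT] := ltnP l (size T); last exact: nth_default.
    by apply/negbTE; move/hasPn: hT => /(_ _ (mem_nth false lT)).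
  split; first by apply/eqP; rewrite -leqn0 leqNgt -has_count.
  by move=> c; rewrite big1 // => l _; rewrite T0.
move=> nz; have jP : j \in P by apply: JP; rewrite mem_head.
have {}JP : {subset J <= P} by move=> i iJ; apply: JP; rewrite inE iJ orbT.
have [/existsP[l /and3P[Tl ejl fl]]|] := boolP [exists l : 'I_s,
    [&& nth false T l, (edge j)`_l != 0 & cross_chain J (set_nth false T l false) != 0]];
  last first.
  rewrite negb_exists => /forallP h; case/eqP: nz.
  apply: (wedge_eq0 (M := k^o)); rewrite size_edge // => l ls Tl; have := h (Ordinal ls).
  rewrite /= Tl /= negb_and !negbK => /orP[/eqP->|/eqP->]; first by rewrite scale0r.
  by rewrite scaler0.
set T' := set_nth false T l false in fl.
have sT' : size T' = s by rewrite size_set_nth sT; apply/maxn_idPr.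
have T'l : nth false T' l = false by rewrite nth_set_nth /= eqxx.
have TE : T = set_nth false T' l true.
  apply: (eq_from_nth (x0 := false)) => [|i _].
    by rewrite size_set_nth sT' sT; apply/esym/maxn_idPr/ltn_ord.
  rewrite !nth_set_nth /= !nth_set_nth /=.
  by case: eqP => [->|].
have [cT' hT'] := IH T' JP sT' fl.
split; first by rewrite TE count_add_vertex // cT'.
move=> c.
have -> : (\sum_(i < s) nth false T i * mon i c =
    mon l c + \sum_(i < s) nth false T' i * mon i c)%N.
  rewrite (bigD1 l) //= Tl mul1n [in RHS](bigD1 l) //= T'l mul0n add0n.
  congr (_ + _)%N; apply: eq_bigr => i il.
  by rewrite nth_set_nth /= val_eqE (negPf il).
rewrite big_cons.
have mono : (nth false T' (lam c) -> nth false T (lam c)) by exact: nth_set_false.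
have [lj|lj] := eqVneq l j.
  subst l; rewrite -addnA leq_add2l; apply: leq_trans (hT' c) _; rewrite leq_add2l.
  by case: (nth false T' _) mono => // ->.
have ll : l = lam (a j).
  apply/eqP; apply: contraNT ejl => ll; rewrite nth_edge (negPf lj) (negPf ll).
  by rewrite subrr.
rewrite ll mon_lam mulmnE mnm1E.
have [ac|ac] := eqVneq (a j) c.
  move: (hT' c); rewrite -ac -ll T'l Tl addn0 => h.
  have := aP jP; rewrite mul1n; move: h.
  set A := (\sum_(i < s) _)%N; set B := (\sum_(i <- J) _)%N; lia.
rewrite mul0n add0n; apply: leq_trans (hT' c) _.
rewrite -addnA; apply: leq_trans (leq_addl _ _); rewrite leq_add2l.
by case: (nth false T' _) mono => // ->.
Qed.

(** The face J itself arises in one way, since no pure power belongs to P. *)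
Lemma cross_face_mask J : uniq J -> {subset J <= P} -> cross_chain J (face_mask J) != 0.
Proof.
elim: J => [|j J IH] /=.
  move=> _ _; case: ifPn; rewrite ?oner_eq0 // has_map => /hasP[l _] /=.
  by rewrite in_nil.
case/andP=> jJ uJ JP; have jP : j \in P by apply: JP; rewrite mem_head.
have {}JP : {subset J <= P} by move=> i iJ; apply: JP; rewrite inE iJ orbT.
have [|||e ->] := @wedge_eq1 _ k^o (edge j) (cross_chain J) (face_mask (j :: J)) j.
- by rewrite size_face_mask size_edge.
- by rewrite nth_face_mask mem_head.
- move=> l' lj ml; have ls : (l' < s)%N.
    by rewrite ltnNge; apply: contraTN ml => sl; rewrite nth_default ?size_face_mask.
  pose l := Ordinal ls; rewrite -[l']/(val l) in lj ml *.
  move: ml; rewrite nth_face_mask inE nth_edge -val_eqE (negPf lj) /= => /JP lP.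
  have /negPf-> : l != lam (a j) by apply: contraTneq lP => ->.
  by rewrite subrr.
have -> : set_nth false (face_mask (j :: J)) j false = face_mask J.
  apply: (eq_from_nth (x0 := false)) => [|i].
    by rewrite size_set_nth !size_face_mask; apply/maxn_idPr.
  rewrite size_set_nth size_face_mask (maxn_idPr (ltn_ord j)) => ils.
  rewrite nth_set_nth /= -[i]/(val (Ordinal ils)) !nth_face_mask inE val_eqE.
  by case: eqP => [->|]; rewrite ?(negPf jJ).
rewrite nth_edge eqxx.
have /negPf-> : j != lam (a j) by apply: contraTneq jP => ->.
rewrite subr0 scale1r scaler_eq0 negb_or signr_eq0 /=.
exact: IH.
Qed.

End CrossPolytope.

(** * A nonvanishing criterion for Tor *)

Section Criterion.
Variables (k : fieldType) (r : nat) (w : 'I_r -> nat) (d : nat).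
Variables (s : nat) (z : 'I_s -> nat).
Variable phi : {lrmorphism {mpoly k[s]} -> veronese k w d}.
Variable mon : 'I_s -> 'X_{1..r}.
Hypothesis d_gt0 : (0 < d)%N.
Hypothesis phiX : forall i, veronese_val (phi 'X_i) = 'X_[mon i].
Hypothesis mon_deg : forall i, mwdeg w (mon i) = (d * z i)%N.
Variables (lam : 'I_r -> 'I_s) (g : 'I_r -> nat).
Hypothesis mon_lam : forall c, mon (lam c) = (U_(c) *+ g c)%MM.

Local Notation val := (@veronese_val k r w d).
Local Notation M := (restrict_scalars phi).
Local Notation Mdeg := (@veronese_deg k r w d).
Local Notation fmon := (face_mon [seq mon i | i <- enum 'I_s]).

Lemma face_mon_varE T c : size T = s ->
  fmon T c = (\sum_(l < s) nth false T l * mon l c)%N.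
Proof.
move=> sT; set L := [seq mon i | i <- enum 'I_s].
have sL : size L = s by rewrite size_map size_enum_ord.
transitivity (\sum_(0 <= i < s) nth false T i * nth 0%MM L i c)%N.
  by rewrite face_monE ?sL // -sL big_mkord.
rewrite big_mkord; apply: eq_bigr => l _; congr (_ * _)%N.
by rewrite (nth_map l) ?size_enum_ord // nth_ord_enum.
Qed.

Lemma mwdeg_face_mon T : size T = s -> mwdeg w (fmon T) = (d * face_deg z T)%N.
Proof.
move=> sT; rewrite /mwdeg /face_deg big_distrr /=.
under eq_bigr do rewrite face_mon_varE // big_distrl /=.
rewrite exchange_big /=; apply: eq_bigr => l _.
rewrite mulnCA -mon_deg /mwdeg big_distrr /=.
by apply: eq_bigr => c _; rewrite mulnA.
Qed.

(** The chain with coefficients [cross_chain] in the multidegree b, the product of m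
    and P, is a cycle with coefficients in M.  It is not a boundary: at the face P its
    monomial is m, and a boundary has there multiples of variables outside P, none
    of which divides m. *)
Theorem tor_dim_neq0 (F : graded_free_resolution z (M := M) Mdeg)
    (m : 'X_{1..r}) (q : nat) (P : {set 'I_s}) (a : 'I_s -> 'I_r) :
  mwdeg w m = (d * q)%N ->
  (forall c, lam c \notin P) ->
  (forall l, l \in P -> (g (a l) <= m (a l) + mon l (a l))%N) ->
  (forall l, (mon l <= m)%MM -> l \in P) ->
  tor_dim F #|P| (\sum_(l in P) z l + q)%N <> 0%N.
Proof.
move=> mq lamP aP mP; set j := (_ + q)%N => tor0.
pose b := (m + \sum_(l <- enum P) mon l)%MM.
have sP : {subset enum P <= P} by move=> l; rewrite mem_enum.
pose f := cross_chain k lam a (enum P).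
have fb T : size T = s -> f T != 0 -> count id T = #|P| /\ (fmon T <= b)%MM.
  move=> sT fT; have [-> h] := cross_support mon_lam aP sP sT fT.
  split; first by rewrite cardE.
  apply/mnm_lepP => c; rewrite face_mon_varE // mnmDE mnm_sumE addnC.
  by apply: leq_trans (h c) _; rewrite leq_add2l; case: ifP.
have bj : mwdeg w b = (d * j)%N.
  rewrite mwdegD mq /j mulnDr addnC; congr (_ + _)%N.
  rewrite (big_morph (mwdeg w) (@mwdegD _ w) (mwdeg0 w)) big_enum /= big_distrr /=.
  by apply: eq_bigr => l _.
(* Only faces whose product divides b occur, so the monomials below are defined. *)
have degE T : size T = s -> f T != 0 ->
    (face_deg z T <= j)%N /\ mwdeg w (b - fmon T) = (d * (j - face_deg z T))%N.
  move=> sT fT; have [_ le] := fb T sT fT.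
  have E : (mwdeg w (b - fmon T) + d * face_deg z T = d * j)%N.
    by rewrite -bj -mwdeg_face_mon // -mwdegD submK.
  have lej : (face_deg z T <= j)%N by rewrite -(leq_pmul2l d_gt0) -E leq_addl.
  by split=> //; rewrite mulnBr -E addnK.
have ex T : exists v : 'rV[{mpoly k[s]}]_(fr_rank F 0), size T = s ->
    [/\ val (augmentation v) = (f T : k) *: 'X_[b - fmon T],
      count id T != #|P| -> v = 0
      & forall c n, n \in msupp (v 0 c) ->
          (mwdeg z n + fr_deg c + face_deg z T = j)%N].
  have [fT|fT] := eqVneq (f T) 0.
    exists 0 => sT; split=> //; last by move=> c n; rewrite mxE mcoeff_msupp mcoeff0 eqxx.
    by rewrite raddf0 fT scale0r.
  have [sT|sT] := eqVneq (size T) s; last by exists 0 => E; rewrite E eqxx in sT.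
  have [cT _] := fb T sT fT; have [lej bT] := degE T sT fT.
  have vP : veronese_pred w d ('X_[b - fmon T] : {mpoly k[r]}).
    by apply/veronese_predP => n; rewrite msuppX inE => /eqP ->; rewrite bT dvdn_mulr.
  have [v vE] := fr_exact_M F ((f T : k) *: Veronese vP : veronese k w d).
  exists (row_part z (@fr_deg _ _ _ _ _ F 0) (j - face_deg z T) v) => _; split.
  - rewrite (val_augmentation_part phiX mon_deg d_gt0) /augmentation -vE.
    rewrite mfilter_id // => n /msuppZ_le; rewrite msuppX inE => /eqP ->.
    by rewrite bT eqxx.
  - by rewrite cT eqxx.
  - by move=> c n /row_partP ->; rewrite subnK.
pose c T := proj1_sig (constructive_indefinite_description _ (ex T)).
have hc T : size T = s ->
    [/\ val (augmentation (c T)) = (f T : k) *: 'X_[b - fmon T],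
      count id T != #|P| -> c T = 0
      & forall a n, n \in msupp (c T 0 a) ->
          (mwdeg z n + fr_deg a + face_deg z T = j)%N].
  by rewrite /c; case: constructive_indefinite_description.
have [|||e he] := @koszul_boundary_of_tor_dim _ _ _ _ _ F #|P| j c _ _ _ tor0.
- by move=> T sT; case: (hc T sT).
- by move=> T c0 n sT; case: (hc T sT) => _ _; apply.
- move=> T sT; apply: veronese_inj; rewrite (val_koszul_d phiX).
  have H := @koszul_d_monomial k r [seq mon l | l <- enum 'I_s] f b.
  rewrite size_map size_enum_ord in H.
  transitivity ((koszul_d (M := k^o) (nseq s 1) f T : k) *: 'X_[b - fmon T] : {mpoly k[r]}).
    rewrite -H //; last by move=> U sU fU; have [] := fb U sU fU.
    apply: (eq_koszul_d (M := {mpoly k[r]}^o)) => [U|].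
      by rewrite size_map size_map size_enum_ord => sU; have [] := hc U sU.
    by rewrite size_map size_map size_enum_ord.
  by rewrite cross_cycle // scale0r.
pose T0 := face_mask (enum P).
have sT0 : size T0 = s by rewrite size_face_mask.
have fT0 : f T0 != 0.
  by apply: (cross_face_mask _ _ lamP) => //; apply: enum_uniq.
have bT0 : (b - fmon T0 = m)%MM.
  apply/mnmP => i; rewrite mnmBE face_mon_varE // mnmDE mnm_sumE big_enum /=.
  rewrite [X in (_ - X)%N](eq_bigr (fun l => if l \in P then mon l i else 0%N)).
    by rewrite -big_mkcond addnK.
  by move=> l _; rewrite nth_face_mask mem_enum; case: ifP; rewrite ?mul1n.
(* Compare the coefficients of m at the face P. *)
have [E _ _] := hc _ sT0; case/eqP: fT0.
have := congr1 (fun x => (val x)@_m) (he _ sT0).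
rewrite E bT0 mcoeffZ mcoeffX eqxx mulr1 => ->.
apply: (koszul_d_ind (Q := fun x : M => (val x)@_m = 0)).
- exact: mcoeff0.
- by move=> x y hx hy; rewrite valD mcoeffD hx hy addr0.
- by move=> x hx; rewrite valN mcoeffN hx oppr0.
- by rewrite sT0 size_map size_enum_ord.
move=> l'; rewrite size_map size_enum_ord => ls; pose l := Ordinal ls.
rewrite -[l']/(nat_of_ord l) nth_face_mask mem_enum => lP.
rewrite (nth_map l) ?size_enum_ord // nth_ord_enum val_scale phiX mcoeff_mulX.
by case: ifP => // /mP; rewrite lP.
Qed.

End Criterion.

(** * Minimal surjections and irreducible monomials *)

Section Irreducible.
Variables (r : nat) (w : 'I_r -> nat) (d : nat).

(** The irreducible elements of the monoid of monomials of degree divisible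
    by d. *)
Definition irreducible_mon (v : 'X_{1..r}) : Prop :=
  [/\ v <> 0%MM, (d %| mwdeg w v)%N &
    forall u1 u2, v = (u1 + u2)%MM -> (d %| mwdeg w u1)%N ->
      (d %| mwdeg w u2)%N -> u1 = 0%MM \/ u2 = 0%MM].

Lemma irreducible_mon_ind (Q : 'X_{1..r} -> Prop) :
  Q 0%MM -> (forall u v, Q u -> Q v -> Q (u + v)%MM) ->
  (forall v, irreducible_mon v -> Q v) ->
  forall v, (d %| mwdeg w v)%N -> Q v.
Proof.
move=> Q0 QD Qi v; have [e] := ubnP (mdeg v).
elim: e v => // e IH v ve dv.
have [->//|/eqP v0] := eqVneq v 0%MM.
case: (excluded_middle_informative (irreducible_mon v)) => [/Qi//|nv].
have [u1 [u2 [vE [d1 d2 u10 u20]]]] : exists u1 u2, v = (u1 + u2)%MM /\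
    [/\ (d %| mwdeg w u1)%N, (d %| mwdeg w u2)%N, u1 != 0%MM & u2 != 0%MM].
  apply: NNPP => h; apply: nv; split=> // u1 u2 vE d1 d2.
  have [->|u10] := eqVneq u1 0%MM; first by left.
  have [->|u20] := eqVneq u2 0%MM; first by right.
  by case: h; exists u1, u2.
move: ve; rewrite vE mdegD; rewrite -mdeg_eq0 in u10; rewrite -mdeg_eq0 in u20 => ve.
by apply: QD; apply: IH => //; lia.
Qed.

End Irreducible.

Section MinimalSurjection.
Variables (k : fieldType) (r : nat) (w : 'I_r -> nat) (d : nat).
Variables (s : nat) (z : 'I_s -> nat).
Variable phi : {lrmorphism {mpoly k[s]} -> veronese k w d}.
Variable mon : 'I_s -> 'X_{1..r}.
Hypothesis phiX : forall i, veronese_val (phi 'X_i) = 'X_[mon i].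
Hypothesis mon_deg : forall i, mwdeg w (mon i) = (d * z i)%N.
Local Notation val := (@veronese_val k r w d).
Local Notation irr := (irreducible_mon w d).

Lemma mon_prodD m1 m2 : mon_prod mon (m1 + m2) = (mon_prod mon m1 + mon_prod mon m2)%MM.
Proof.
by apply/mnmP => c; rewrite mnmDE !mnm_sumE -big_split; apply: eq_bigr => i _;
   rewrite !mulmnE mnmDE mulnDr.
Qed.

Lemma mon_prod1 i : mon_prod mon U_(i) = mon i.
Proof.
apply/mnmP => c; rewrite mnm_sumE (bigD1 i) //= mulmnE mnm1E eqxx muln1.
by rewrite big1 ?addn0 // => l il; rewrite mulmnE mnm1E eq_sym (negPf il) muln0.
Qed.

Lemma mon_prod0 : mon_prod mon 0 = 0%MM.
Proof. by apply/mnmP => c; rewrite mnm_sumE big1 ?mnm0E // => i _; rewrite mulmnE mnm0E muln0. Qed.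

(** Some monomial of a preimage of v maps to v, and a product equal to v has only one
    nontrivial factor. *)
Lemma irreducible_var : generates phi [set: 'I_s] ->
  forall v, irr v -> exists i, mon i = v.
Proof.
move=> gen v [v0 dv vi].
have vP : veronese_pred w d ('X_[v] : {mpoly k[r]}).
  by apply/veronese_predP => n; rewrite msuppX inE => /eqP ->.
have [p _ pv] := gen (Veronese vP).
have : v \in msupp (val (phi p)) by rewrite pv msuppX mem_head.
case/(msupp_val_phi phiX) => m _ vE.
have [i /andP[mi moni]] : exists i, (m i != 0%N) && (mon i != 0%MM).
  apply/existsP; apply: contraPT (v0) => /existsPn h; rewrite vE; apply.
  apply/mnmP => c; rewrite mnm_sumE mnm0E big1 // => i _.
  have := h i; rewrite negb_and !negbK => /orP[/eqP->|/eqP->]; rewrite ?mulm0n ?mnm0E //.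
  by rewrite mulmnE mnm0E.
have mE : m = (U_(i) + (m - U_(i)))%MM by rewrite addmC submK // lep1mP.
rewrite mE mon_prodD mon_prod1 in vE.
exists i; case: (vi _ _ vE) => [||E|E]; last by rewrite vE E addm0.
- by rewrite mon_deg dvdn_mulr.
- by rewrite (mwdeg_mon_prod mon_deg) dvdn_mulr.
by rewrite E eqxx in moni.
Qed.

Lemma generates_of_irreducible (P : {set 'I_s}) :
  (forall v, irr v -> exists2 i, i \in P & mon i = v) -> generates phi P.
Proof.
move=> hP f.
have ex v : exists m : 'X_{1..s}, (d %| mwdeg w v)%N ->
    (forall i, m i != 0%N -> i \in P) /\ mon_prod mon m = v.
  case: (boolP (d %| mwdeg w v)%N) => [dv|]; last by exists 0%MM.
  suff [m hm] : exists m : 'X_{1..s}, (forall i, m i != 0%N -> i \in P)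
      /\ mon_prod mon m = v by exists m.
  elim/(@irreducible_mon_ind r w d): v / dv.
  - by exists 0%MM; split=> [i|]; rewrite ?mnm0E ?mon_prod0.
  - move=> u v [m1 [h1 <-]] [m2 [h2 <-]]; exists (m1 + m2)%MM; split; last exact: mon_prodD.
    by move=> i; rewrite mnmDE addn_eq0 negb_and => /orP[/h1|/h2].
  - move=> v /hP[i iP <-]; exists U_(i)%MM; split; last exact: mon_prod1.
    by move=> l; rewrite mnm1E; have [<-|] := eqVneq i l.
pose M v := proj1_sig (constructive_indefinite_description _ (ex v)).
have hM v : (d %| mwdeg w v)%N ->
    (forall i, M v i != 0%N -> i \in P) /\ mon_prod mon (M v) = v.
  by rewrite /M; case: constructive_indefinite_description.
have df v : v \in msupp (val f) -> (d %| mwdeg w v)%N.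
  by move: v; apply/veronese_predP; case: f.
exists (\sum_(v <- msupp (val f)) (val f)@_v *: 'X_[M v]).
  move=> m i; rewrite mcoeff_msupp raddf_sum /= => nz mi.
  have [/hasP[v vf /eqP vm]|/hasPn h] := boolP (has (fun v => M v == m) (msupp (val f))).
    by apply: (hM v (df v vf)).1; rewrite vm.
  case/eqP: nz; rewrite big_seq big1 // => v /h /negPf vm.
  by rewrite mcoeffZ mcoeffX vm mulr0.
apply: veronese_inj; rewrite linear_sum /= val_sum [RHS]mpolyE.
rewrite !big_seq; apply: eq_bigr => v vf.
rewrite linearZ -[val _]/((val f)@_v *: val (phi 'X_[M v])) (val_phiX phiX).
by rewrite (hM v (df v vf)).2.
Qed.

Hypothesis phi_min : minimal_surjection z phi.

(** A variable mapping to a reducible monomial could be dropped, the irreducible ones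
    being the values of other variables; this contradicts minimality. *)
Lemma mon_irreducible i : irr (mon i).
Proof.
have [_ gen min] := phi_min; apply: NNPP => ni.
apply: (min [set~ i]).
  rewrite properT; apply/eqP => /setP/(_ i).
  by rewrite !inE eqxx.
apply: generates_of_irreducible => v vi; have [l lv] := irreducible_var gen vi.
exists l => //; rewrite !inE; apply/eqP => li; apply: ni.
by rewrite -li lv.
Qed.

Lemma mon_inj : injective mon.
Proof.
have [_ gen min] := phi_min => i j ij; apply/eqP/negPn/negP => nij.
apply: (min [set~ i]).
  rewrite properT; apply/eqP => /setP/(_ i).
  by rewrite !inE eqxx.
apply: generates_of_irreducible => v vi; have [l lv] := irreducible_var gen vi.
have [li|li] := eqVneq l i; last by exists l; rewrite ?inE.
by exists j; rewrite ?inE 1?eq_sym // -ij -li.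
Qed.

End MinimalSurjection.

(** * The Veronese monoid for the weights 1, ..., 1, 2 *)

Section Weights.
Variable n : nat.
Local Notation w := (@weights_1n2 n).
Implicit Types (u v : 'X_{1..n.+1}).

(** Indexed by nat, because the monomials used later are given by functions on nat. *)
Definition xdeg v : nat := (\sum_(0 <= c < n) v (inord c))%N.

Lemma mwdeg_1n2 v : mwdeg w v = (xdeg v + (v ord_max).*2)%N.
Proof.
rewrite /mwdeg big_ord_recr /= /weights_1n2 eqxx muln2; congr (_ + _)%N.
rewrite /xdeg big_mkord; apply: eq_bigr => c _.
have -> : inord c = widen_ord (leqnSn n) c.
  by apply: val_inj; rewrite /= inordK // ltnS ltnW.
by rewrite -val_eqE /= ltn_eqF ?muln1.
Qed.

Lemma xdegD u v : xdeg (u + v)%MM = (xdeg u + xdeg v)%N.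
Proof. by rewrite /xdeg -big_split; apply: eq_bigr => c _; rewrite mnmDE. Qed.

Lemma leq_xdeg v c : (c < n)%N -> (v (inord c) <= xdeg v)%N.
Proof. by move=> cn; rewrite /xdeg (bigD1_seq c) ?mem_index_iota ?iota_uniq //= leq_addr. Qed.

Lemma ord_case (c : 'I_n.+1) : c = ord_max \/ exists2 i, (i < n)%N & c = inord i.
Proof.
have := ltn_ord c; rewrite ltnS leq_eqVlt => /orP[/eqP cn|cn].
  by left; apply: val_inj.
by right; exists c; rewrite ?inord_val.
Qed.

Lemma mwdeg_1n2_eq0 v : mwdeg w v = 0%N -> v = 0%MM.
Proof.
rewrite mwdeg_1n2 => h; apply/mnmP => c; rewrite mnm0E.
case: (ord_case c) => [->|[i il ->]]; first lia.
by have := leq_xdeg v il; lia.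
Qed.

Lemma sub_monomial v t : (t <= xdeg v)%N ->
  exists u, [/\ (u <= v)%MM, u ord_max = 0%N & xdeg u = t].
Proof.
elim: t => [_|t IH tv].
  exists 0%MM; split; last by rewrite /xdeg big1 // => c _; rewrite mnm0E.
    by apply/mnm_lepP => c; rewrite mnm0E.
  by rewrite mnm0E.
have [u [/mnm_lepP uv u0 ut]] := IH (ltnW tv).
have [/hasP[c]|/hasPn h] := boolP (has (fun c => u (inord c) < v (inord c))%N (index_iota 0 n)).
  rewrite mem_index_iota /= => cn uc; exists (u + U_(inord c))%MM; split.
  - apply/mnm_lepP => e; rewrite mnmDE mnm1E; have [<-|ne] := eqVneq (inord c) e.
      by rewrite addn1.
    by rewrite addn0.
  - rewrite mnmDE u0 mnm1E; case: eqP => // /(congr1 val) /=.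
    by rewrite inordK ?ltnS 1?ltnW //; lia.
  rewrite xdegD ut; rewrite /xdeg (bigD1_seq c) ?mem_index_iota ?iota_uniq //=.
  rewrite mnm1E eqxx big_seq_cond big1 ?addn1 // => e /andP[].
  rewrite mem_index_iota /= => en ec; rewrite mnm1E; case: eqP => // /(congr1 val) /=.
  by rewrite !inordK ?ltnS 1?ltnW // => E; rewrite E eqxx in ec.
have : (xdeg v <= xdeg u)%N.
  rewrite /xdeg !big_seq; apply: leq_sum => c /h; rewrite -leqNgt //.
by lia.
Qed.

Lemma xdeg_ypow e : xdeg (U_(ord_max) *+ e)%MM = 0%N.
Proof.
rewrite /xdeg big_seq big1 // => c; rewrite mem_index_iota /= => cn.
rewrite mulmnE mnm1E; case: eqP => // /(congr1 val) /=.
by rewrite inordK ?ltnS 1?ltnW //; lia.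
Qed.

Lemma ypow_max e : (U_(ord_max) *+ e)%MM (ord_max : 'I_n.+1) = e.
Proof. by rewrite mulmnE mnm1E eqxx mul1n. Qed.

Variable d : nat.
Hypothesis d_gt0 : (0 < d)%N.
Local Notation irr := (irreducible_mon w d).

Lemma irreducible_deg v : mwdeg w v = d -> irr v.
Proof.
move=> vd; split; first by move=> v0; move: vd; rewrite v0 mwdeg0; lia.
  by rewrite vd.
move=> u1 u2 vE /dvdnP[e1 E1] /dvdnP[e2 E2].
have : (e1 + e2 = 1)%N.
  by apply/eqP; rewrite -(eqn_pmul2r d_gt0) mulnDl -E1 -E2 -mwdegD -vE vd mul1n.
case: e1 E1 => [|e1] E1; first by left; apply: mwdeg_1n2_eq0.
by case: e2 E2 => [|e2] E2; [right; apply: mwdeg_1n2_eq0 | lia].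
Qed.

(** For odd d, a power of the last variable has degree divisible by d only if its
    exponent is divisible by d. *)
Lemma ypow_irreducible : odd d -> irr (U_(ord_max) *+ d)%MM.
Proof.
move=> od; split.
- by move/mnmP/(_ ord_max); rewrite ypow_max mnm0E; lia.
- by rewrite mwdeg_1n2 xdeg_ypow ypow_max add0n -muln2 dvdn_mulr.
move=> u1 u2 E.
have X : (xdeg u1 + xdeg u2 = 0)%N by rewrite -xdegD -E xdeg_ypow.
have Y : (u1 ord_max + u2 ord_max = d)%N by rewrite -mnmDE -E ypow_max.
have X1 : xdeg u1 = 0%N by lia.
have X2 : xdeg u2 = 0%N by lia.
rewrite !mwdeg_1n2 X1 X2 !add0n -!muln2 !Gauss_dvdl ?coprimen2 // => d1 d2.
have [y1|y1] := posnP (u1 ord_max).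
  by left; apply: mwdeg_1n2_eq0; rewrite mwdeg_1n2 X1 y1.
right; apply: mwdeg_1n2_eq0; rewrite mwdeg_1n2 X2.
have := dvdn_leq y1 d1; lia.
Qed.

(** Every monomial of degree de with e > 1 is divisible by a monomial of degree d or
    by the d-th power of the last variable: take as large a power of the last
    variable as fits into degree d, and complete it by other variables.  This fails
    only if d is odd and there are none. *)
Lemma irreducible_1n2 v : irr v ->
  mwdeg w v = d \/ odd d /\ v = (U_(ord_max) *+ d)%MM.
Proof.
move=> [v0 /dvdnP[e ve] vi].
have e0 : e <> 0%N by move=> e0; apply: v0; apply: mwdeg_1n2_eq0; rewrite ve e0.
have sub u : (u <= v)%MM -> (d %| mwdeg w u)%N -> u <> 0%MM -> v = u.
  move=> uv du u0; have vE : v = (u + (v - u))%MM by rewrite addmC submK.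
  case: (vi _ _ vE du) => [||E]; last by rewrite vE E addm0.
    by rewrite -(dvdn_addr _ du) -mwdegD -vE ve dvdn_mull.
  by move/u0.
set y := v ord_max; set a := xdeg v; rewrite mwdeg_1n2 -/y -/a in ve.
pose y' := minn y d./2.
have [small|big] := leqP (d - y'.*2) a; last first.
  right; have yd : (d./2 <= y)%N by nia.
  have a0 : a = 0%N by lia.
  have od : odd d by move: (odd_double_half d); case: (odd d) => //; lia.
  split=> //; apply: sub; last 1 first.
  - by move/mnmP/(_ ord_max); rewrite ypow_max mnm0E; lia.
  - apply/mnm_lepP => c; rewrite mulmnE mnm1E; case: eqP => [<-|//].
    rewrite mul1n -/y; have : (d %| y)%N.
      by rewrite -(@Gauss_dvdl d y 2) ?coprimen2 // muln2; apply/dvdnP; exists e; lia.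
    by move/dvdn_leq; apply; lia.
  by rewrite mwdeg_1n2 xdeg_ypow ypow_max add0n -muln2 dvdn_mulr.
left; have [u [/mnm_lepP uv u0 ux]] := sub_monomial small.
pose u' := (u + U_(ord_max) *+ y')%MM.
have u'd : mwdeg w u' = d.
  rewrite mwdeg_1n2 xdegD xdeg_ypow mnmDE u0 ypow_max ux addn0 add0n subnK //.
  by rewrite /y'; lia.
rewrite (sub u') ?u'd //; last by move=> E; move: u'd; rewrite E mwdeg0; lia.
apply/mnm_lepP => c; rewrite mnmDE mulmnE mnm1E; case: eqP => [<-|].
  by rewrite u0 mul1n geq_minl.
by rewrite addn0.
Qed.

(** The exponents of the pure powers among the generators.  The last variable y has
    weight 2: for even d its power of degree d is y^(d/2), and for odd d the smallest
    power in the Veronese ring is y^d, of degree 2d. *)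
Definition pure_exp (c : 'I_n.+1) : nat :=
  if c == ord_max then (if odd d then d else d./2) else d.

Lemma pure_irreducible c : irr (U_(c) *+ pure_exp c)%MM.
Proof.
rewrite /pure_exp; case: eqP => [->|/eqP cm].
  case: ifP => [/ypow_irreducible//|od]; apply: irreducible_deg.
  by rewrite mwdeg_1n2 xdeg_ypow ypow_max; move: (odd_double_half d); rewrite od.
apply: irreducible_deg; rewrite /mwdeg (bigD1 c) //= mulmnE mnm1E eqxx mul1n.
rewrite {1}/weights_1n2 (negPf cm) muln1 big1 ?addn0 // => i ic.
by rewrite mulmnE mnm1E eq_sym (negPf ic).
Qed.

End Weights.

Lemma set_between (T : finType) (A B : {set T}) i : A \subset B ->
  (#|A| <= i <= #|B|)%N -> exists P : {set T}, [/\ A \subset P, P \subset B & #|P| = i].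
Proof.
move=> AB /andP[Ai]; elim: i Ai => [|i IH] Ai iB.
  by exists A; split=> //; apply/eqP; rewrite -leqn0.
have [E|ne] := eqVneq #|A| i.+1; first by exists A.
have [|P [AP PB Pi]] := IH _ (ltnW iB); first by rewrite leq_eqVlt (negPf ne) in Ai.
have /subsetPn[x xB xP] : ~~ (B \subset P).
  by apply: contraTN iB => /subset_leq_card; rewrite Pi -leqNgt.
exists (x |: P); split.
- by apply: subset_trans AP _; apply: subsetU1.
- by rewrite subUset sub1set xB.
- by rewrite cardsU1 xP Pi.
Qed.

(** * Counting generators *)

Section Generators.
Variables (n d N : nat) (mon : 'I_N.+1 -> 'X_{1..n.+1}) (lam : 'I_n.+1 -> 'I_N.+1).
Local Notation w := (@weights_1n2 n).
Local Notation g := (pure_exp d).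

Definition pure_vars : {set 'I_N.+1} := [set lam c | c : 'I_n.+1].

Definition divisors_of (m : 'X_{1..n.+1}) : {set 'I_N.+1} := [set i | (mon i <= m)%MM].

(** The variables that may occur in the cycle attached to m: they kill m modulo the
    pure powers, without being pure powers. *)
Definition killing (m : 'X_{1..n.+1}) : {set 'I_N.+1} :=
  [set i | (i \notin pure_vars) && [exists c, (g c <= m c + mon i c)%N]].

Definition surviving (m : 'X_{1..n.+1}) : {set 'I_N.+1} :=
  [set i | (i \notin pure_vars) && [forall c, (m c + mon i c < g c)%N]].

Lemma card_killing (m : 'X_{1..n.+1}) : (N <= #|killing m| + n + #|surviving m|)%N.
Proof.
have : [set: 'I_N.+1] \subset killing m :|: (surviving m :|: pure_vars).
  apply/subsetP => i _; rewrite !inE; case: (i \in pure_vars); rewrite ?orbT //=.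
  rewrite orbF; apply/orP; case: (boolP [exists c, _]) => [|/existsPn h]; first by left.
  by right; apply/forallP => c; rewrite ltnNge.
move/subset_leq_card; rewrite cardsT card_ord => h.
have h1 := cardsU (killing m) (surviving m :|: pure_vars).
have h2 := cardsU (surviving m) pure_vars.
have h3 : (#|pure_vars| <= n.+1)%N by rewrite (leq_trans (leq_imset_card _ _)) ?card_ord.
lia.
Qed.

Hypothesis mon_inj : injective mon.

(** A set of generators of degree d is counted by the exponents it leaves free:
    those of the variables a, ..., b - 1, bounded by D, and that of the variable
    c1, bounded by B; the exponent of c0 is then determined by the degree. *)
Lemma card_exponents (A : {set 'I_N.+1}) (c0 c1 : 'I_n.+1) (a b D B : nat) :
  (forall i, i \in A -> mwdeg w (mon i) = d) ->
  (forall i (c : 'I_n.+1), i \in A -> (a <= c < b)%N -> (mon i c <= D)%N) ->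
  (forall i, i \in A -> (mon i c1 <= B)%N) ->
  (forall i (c : 'I_n.+1), i \in A -> c != c0 -> c != c1 -> ~~ (a <= c < b)%N -> mon i c = 0%N) ->
  (#|A| <= D.+1 ^ (b - a) * B.+1)%N.
Proof.
move=> Ad AD AB A0.
pose F i : {ffun 'I_(b - a) -> 'I_D.+1} * 'I_B.+1 :=
  ([ffun x : 'I_(b - a) => inord (mon i (inord (a + x)))], inord (mon i c1)).
have Finj : {in A &, injective F}.
  move=> i j iA jA [/ffunP E1 /(congr1 val) /=]; rewrite !inordK ?ltnS ?AB // => E2.
  apply: mon_inj.
  have E c : c != c0 -> mon i c = mon j c.
    move=> cc0; have [->//|cc1] := eqVneq c c1.
    have [cab|cab] := boolP (a <= c < b)%N; last by rewrite !A0.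
    have xb : (c - a < b - a)%N by lia.
    have := congr1 val (E1 (Ordinal xb)); rewrite !ffunE /= subnKC; last by lia.
    by rewrite inord_val !inordK // ltnS AD.
  apply/mnmP => c; have [->|] := eqVneq c c0; last exact: E.
  have := Ad i iA; rewrite -(Ad j jA) /mwdeg (bigD1 c0) //= [in RHS](bigD1 c0) //=.
  rewrite (eq_bigr (fun c => mon j c * w c)%N); last by move=> e ec0; rewrite E.
  move/addIn/eqP; rewrite eqn_pmul2r; first by move/eqP.
  by rewrite /weights_1n2; case: ifP.
rewrite -(card_in_imset Finj); apply: leq_trans (max_card _) _.
by rewrite card_prod card_ffun !card_ord.
Qed.

Hypothesis d_gt0 : (0 < d)%N.
Hypothesis mon_irr : forall i, irreducible_mon w d (mon i).
Hypothesis mon_lam : forall c, mon (lam c) = (U_(c) *+ g c)%MM.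

Lemma mwdeg_non_pure i : i \notin pure_vars -> mwdeg w (mon i) = d.
Proof.
move=> iL; case: (irreducible_1n2 d_gt0 (mon_irr i)) => // -[od E].
case/negP: iL; apply/imsetP; exists ord_max => //; apply: mon_inj.
by rewrite mon_lam E /pure_exp eqxx od.
Qed.

End Generators.

Section Nonvanishing.
Variables (k : fieldType) (n d N : nat) (z : 'I_N.+1 -> nat).
Local Notation w := (@weights_1n2 n).
Variable phi : {lrmorphism {mpoly k[N.+1]} -> veronese k w d}.
Hypothesis d_gt0 : (0 < d)%N.
Hypothesis phi_min : minimal_surjection z phi.

(** The homological input to the statement.  A set P as in [tor_dim_neq0] of any size
    between the two bounds is obtained by adding killers to the divisors of m; its
    elements have degree 1, so the internal degree is i + q. *)
Lemma betti_neq0 : exists (mon : 'I_N.+1 -> 'X_{1..n.+1}) (lam : 'I_n.+1 -> 'I_N.+1),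
  [/\ injective mon,
      forall i, irreducible_mon w d (mon i),
      forall v, irreducible_mon w d v -> exists i, mon i = v,
      forall c, mon (lam c) = (U_(c) *+ pure_exp d c)%MM &
      forall (m : 'X_{1..n.+1}) q i, mwdeg w m = (d * q)%N ->
        divisors_of mon m \subset killing d mon lam m ->
        (#|divisors_of mon m| <= i <= #|killing d mon lam m|)%N ->
        betti z (M := restrict_scalars phi) (@veronese_deg k n.+1 w d) i (i + q)
          <> 0%N].
Proof.
have [monP gen _] := phi_min.
have /fin_all_exists2[mon phiX mon_deg] := monP.
have irrP := irreducible_var phiX mon_deg gen.
have inj := mon_inj phiX mon_deg phi_min.
have irr := mon_irreducible phiX mon_deg phi_min.
have /fin_all_exists[lam mon_lam] c := irrP _ (pure_irreducible d_gt0 c).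
exists mon, lam; split=> // m q i mq DZ le.
have [P [DP PZ Pi]] := set_between DZ le.
have PZ' l : l \in P -> l \notin pure_vars lam /\
    exists c, (pure_exp d c <= m c + mon l c)%N.
  by move/(subsetP PZ); rewrite inE => /andP[? /existsP].
have lamP c : lam c \notin P.
  by apply/negP => /PZ'[/negP[]]; apply: imset_f.
have /fin_all_exists[a aP] (l : 'I_N.+1) : exists c,
    l \in P -> (pure_exp d c <= m c + mon l c)%N.
  by have [/PZ'[_ [c hc]]|_] := boolP (l \in P); [exists c | exists ord_max].
have zP : (\sum_(l in P) z l = i)%N.
  rewrite -Pi -sum1_card; apply: eq_bigr => l /PZ'[lL _].
  have := mon_deg l; rewrite (mwdeg_non_pure inj d_gt0 irr mon_lam) //.
  by rewrite -{1}[d]muln1 => /eqP; rewrite eqn_pmul2l // => /eqP.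
rewrite /betti.
set E := fun b => _; have Ex : exists b, E b.
  have [|F] := veronese_resolution phiX mon_deg d_gt0 (z := z) (phi := phi).
    by move=> x; have [p _ px] := gen x; exists p.
  by exists (tor_dim F i (i + q)), F.
have [F ->] := epsilon_spec (inhabits 0%N) E Ex.
rewrite -{1}Pi -zP; apply: (tor_dim_neq0 d_gt0 phiX mon_deg mon_lam mq lamP aP).
- by move=> l lm; apply: (subsetP DP); rewrite inE.
Qed.

End Nonvanishing.

(** * Three families of monomials *)

Section Monomials.
Variables (n d : nat).

Definition monomial (F : nat -> nat) (y : nat) : 'X_{1..n.+1} :=
  [multinom if c == ord_max then y else F c | c < n.+1].

Lemma monomial_max F y : monomial F y ord_max = y.
Proof. by rewrite mnmE eqxx. Qed.

Lemma monomial_x F y (c : 'I_n.+1) : (c < n)%N -> monomial F y c = F c.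
Proof. by move=> cn; rewrite mnmE -val_eqE /= ltn_eqF. Qed.

Lemma monomial_nat F y c : (c < n)%N -> monomial F y (inord c) = F c.
Proof. by move=> cn; rewrite monomial_x inordK // ltnS ltnW. Qed.

Lemma xdeg_monomial F y : xdeg (monomial F y) = (\sum_(0 <= c < n) F c)%N.
Proof.
rewrite /xdeg; apply: eq_big_nat => c /= cn.
by rewrite monomial_nat.
Qed.

Lemma pure_exp_x (c : 'I_n.+1) : (c < n)%N -> pure_exp d c = d.
Proof. by move=> cn; rewrite /pure_exp -val_eqE /= ltn_eqF. Qed.

Lemma pure_exp_nat c : (c < n)%N -> pure_exp d (inord c : 'I_n.+1) = d.
Proof. by move=> cn; rewrite pure_exp_x // inordK // ltnS ltnW. Qed.

Lemma pure_exp_max : pure_exp d (ord_max : 'I_n.+1) = if odd d then d else d./2.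
Proof. by rewrite /pure_exp eqxx. Qed.

Lemma pure_exp_le (c : 'I_n.+1) : (pure_exp d c <= d)%N.
Proof. by rewrite /pure_exp; case: eqP => // _; case: ifP => //; lia. Qed.

Lemma ord_lt_max (c : 'I_n.+1) : c != ord_max -> (c < n)%N.
Proof. by have := ltn_ord c; rewrite ltnS leq_eqVlt -val_eqE /= => /orP[->|]. Qed.

Definition stair (q a b c : nat) : nat :=
  if (c < q)%N then a else if c == q then b else 0%N.

Lemma sum_stair q a b m :
  (\sum_(0 <= c < m) stair q a b c = minn m q * a + (if q < m then b else 0))%N.
Proof.
elim: m => [|m IH]; first by rewrite big_geq // min0n mul0n.
rewrite big_nat_recr //= IH /stair ltnS.
have -> : minn m.+1 q = (minn m q + (m < q))%N by lia.
rewrite mulnDl; set P := (minn m q * a)%N.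
by case: (ltngtP m q) => _; rewrite ?mul1n ?mul0n; lia.
Qed.

End Monomials.

Section Families.
Variables (n d N : nat) (mon : 'I_N.+1 -> 'X_{1..n.+1}) (lam : 'I_n.+1 -> 'I_N.+1).
Local Notation w := (@weights_1n2 n).
Local Notation irr := (irreducible_mon w d).
Hypothesis n_gt1 : (1 < n)%N.
Hypothesis d_gt0 : (0 < d)%N.
Hypothesis mon_inj : injective mon.
Hypothesis mon_irr : forall i, irr (mon i).
Hypothesis irr_mon : forall v, irr v -> exists i, mon i = v.
Hypothesis mon_lam : forall c, mon (lam c) = (U_(c) *+ pure_exp d c)%MM.
Local Notation D := (divisors_of mon).
Local Notation Z := (killing d mon lam).
Local Notation bad := (surviving d mon lam).

Let deg_mon i : i \notin pure_vars lam -> mwdeg w (mon i) = d.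
Proof. exact: mwdeg_non_pure. Qed.

Lemma divisor_non_pure (m : 'X_{1..n.+1}) i : (forall c, (m c < pure_exp d c)%N) -> i \in D m ->
  i \notin pure_vars lam.
Proof.
move=> mred; rewrite inE => /mnm_lepP le; apply/imsetP => -[c _ ic].
by have := le c; rewrite ic mon_lam mulmnE mnm1E eqxx mul1n leqNgt mred.
Qed.

Lemma divisors_sub_killing (m : 'X_{1..n.+1}) : (forall c, (m c < pure_exp d c)%N) ->
  (forall i, i \in D m -> i \notin bad m) -> D m \subset Z m.
Proof.
move=> mred nb; apply/subsetP => i iD; have iL := divisor_non_pure mred iD.
have := nb i iD; rewrite !inE iL /= => /forallPn[c hc].
by apply/existsP; exists c; rewrite leqNgt.
Qed.

Lemma surviving_lt (m : 'X_{1..n.+1}) i c : i \in bad m -> (m c + mon i c < pure_exp d c)%N.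
Proof. by rewrite inE => /andP[_ /forallP]. Qed.

Lemma surviving_deg (m : 'X_{1..n.+1}) i : i \in bad m -> mwdeg w (mon i) = d.
Proof. by rewrite inE => /andP[/deg_mon]. Qed.

(** Its first q exponents are saturated and x_q brings the degree to dq.  A divisor of
    degree d is determined by q exponents of which one is at most q; a generator that
    does not kill it involves only the other n - q + 1 variables. *)
Definition full_x q := monomial n (stair q d.-1 q) 0.

Section FullX.
Variable q : nat.
Hypothesis q_gt0 : (0 < q)%N.
Hypothesis q_lt_n : (q < n)%N.
Hypothesis n_lt_d : (n < d)%N.

Lemma mwdeg_full_x : mwdeg w (full_x q) = (d * q)%N.
Proof.
rewrite mwdeg_1n2 xdeg_monomial sum_stair monomial_max (minn_idPr (ltnW q_lt_n)) q_lt_n.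
by rewrite addn0 -mulnSr prednK // mulnC.
Qed.

Lemma full_x_reduced c : (full_x q c < pure_exp d c)%N.
Proof.
have [->|/ord_lt_max cn] := eqVneq c ord_max.
  by rewrite monomial_max pure_exp_max; case: ifP => //; lia.
by rewrite monomial_x // pure_exp_x // /stair; case: ifP => _; [lia | case: ifP => _; lia].
Qed.

Lemma full_x_surviving i c : i \in bad (full_x q) -> (c < q)%N -> mon i (inord c) = 0%N.
Proof.
move=> ib cq; have cn : (c < n)%N by apply: leq_trans q_lt_n; apply: leqW.
have := surviving_lt (inord c) ib.
by rewrite monomial_nat // pure_exp_nat // /stair cq; lia.
Qed.

(** A divisor of degree d that is disjoint from the saturated variables would be a
    power of x_q with exponent at most q, which is less than d. *)
Lemma full_x_divisors : D (full_x q) \subset Z (full_x q).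
Proof.
apply: divisors_sub_killing => [c|i]; first exact: full_x_reduced.
rewrite inE => /mnm_lepP le; apply/negP => ib.
have := surviving_deg ib; rewrite mwdeg_1n2.
have := le ord_max; rewrite monomial_max leqn0 => /eqP ->; rewrite addn0 => xd.
have : (xdeg (mon i) <= \sum_(0 <= c < n) stair q 0 q c)%N.
  rewrite /xdeg !big_seq; apply: leq_sum => c; rewrite mem_index_iota /= => cn.
  have [cq|cq] := ltnP c q; first by rewrite (full_x_surviving ib cq).
  apply: leq_trans (le (inord c)) _; rewrite monomial_nat //.
  by rewrite /stair ltnNge cq.
by rewrite sum_stair muln0 q_lt_n xd; lia.
Qed.

Lemma card_full_x_divisors : (#|D (full_x q)| <= d ^ (q - 1) * q.+1)%N.
Proof.
rewrite -{1}(prednK d_gt0).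
apply: (card_exponents (d := d) mon_inj (c0 := inord 0) (c1 := inord q)).
- by move=> i /(divisor_non_pure full_x_reduced)/deg_mon.
- move=> i c; rewrite inE => /mnm_lepP/(_ c) le cab; apply: leq_trans le _.
  by rewrite monomial_x /stair; [case: ifP => _; [|case: ifP]; lia | lia].
- move=> i; rewrite inE => /mnm_lepP/(_ (inord q)) le; apply: leq_trans le _.
  by rewrite monomial_nat // /stair ltnn eqxx.
move=> i c; rewrite inE => /mnm_lepP/(_ c) le c0 c1 cab; apply/eqP.
rewrite -leqn0; apply: leq_trans le _.
have [->|/ord_lt_max cn] := eqVneq c ord_max; first by rewrite monomial_max.
rewrite -val_eqE /= inordK // in c0; rewrite -val_eqE /= inordK ?ltnS 1?ltnW // in c1.
by rewrite monomial_x // /stair (negPf c1); case: ifP => //; lia.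
Qed.

Lemma card_full_x_surviving : (#|bad (full_x q)| <= d.+1 ^ (n - q))%N.
Proof.
rewrite -[X in (_ <= X)%N]muln1.
apply: (card_exponents (d := d) mon_inj (c0 := ord_max) (c1 := inord 0)).
- by move=> i /surviving_deg.
- by move=> i c /(surviving_lt c) lt _; have := pure_exp_le d c; lia.
- by move=> i ib; rewrite (full_x_surviving ib).
move=> i c ib /ord_lt_max cn _ cab.
by rewrite -[c]inord_val (full_x_surviving ib) //; lia.
Qed.

End FullX.

(** In row 1 the monomial is itself a generator, hence its only divisor; the range
    therefore starts at 1. *)
Lemma card_full_x1_divisors : (n < d)%N -> (#|D (full_x 1)| <= 1)%N.
Proof.
move=> nd; have iE i : i \in D (full_x 1) -> mon i = full_x 1.
  move=> iD; have iL : i \notin pure_vars lam.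
    by apply: divisor_non_pure iD => c; apply: full_x_reduced.
  move: iD; rewrite inE => le.
  have : mwdeg w (full_x 1 - mon i)%MM = 0%N.
    have : mwdeg w (full_x 1) = (d * 1)%N by apply: mwdeg_full_x.
    by rewrite -{1}(submK le) mwdegD deg_mon // muln1; lia.
  by move/mwdeg_1n2_eq0 => E; rewrite -(submK le) E add0m.
have [->|[i0 i0D]] := set_0Vmem (D (full_x 1)); first by rewrite cards0.
rewrite -[X in (_ <= X)%N](cards1 i0); apply: subset_leq_card.
apply/subsetP => i iD; rewrite inE.
by apply/eqP/mon_inj; rewrite (iE _ iD) (iE _ i0D).
Qed.

(** The exponent of y is saturated too, which for odd d accounts for degree 2(d - 1)
    with a single variable; so a divisor of degree d has one free exponent less than
    for [full_x]. *)
Definition full_xy q := monomial n (stair (q - 2) d.-1 q) d.-1.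

Section FullXY.
Variable q : nat.
Hypothesis d_odd : odd d.
Hypothesis q_gt1 : (1 < q)%N.
Hypothesis q_le : (q <= n.+1)%N.
Hypothesis n_lt_d : (n.+1 < d)%N.

Let q2n : (q - 2 < n)%N. Proof. lia. Qed.

Lemma mwdeg_full_xy : mwdeg w (full_xy q) = (d * q)%N.
Proof.
rewrite mwdeg_1n2 xdeg_monomial sum_stair monomial_max (minn_idPr (ltnW q2n)) q2n.
by case: q q_gt1 => [|[|q']] // _; case: d d_gt0 => // d' _; rewrite !subSS subn0 /=; nia.
Qed.

Lemma full_xy_reduced c : (full_xy q c < pure_exp d c)%N.
Proof.
have [->|/ord_lt_max cn] := eqVneq c ord_max.
  by rewrite monomial_max pure_exp_max d_odd; lia.
by rewrite monomial_x // pure_exp_x // /stair; case: ifP => _; [lia | case: ifP => _; lia].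
Qed.

Lemma full_xy_surviving_max i : i \in bad (full_xy q) -> mon i ord_max = 0%N.
Proof.
by move/(surviving_lt ord_max); rewrite monomial_max pure_exp_max d_odd; lia.
Qed.

Lemma full_xy_surviving i c : i \in bad (full_xy q) -> (c < q - 2)%N -> mon i (inord c) = 0%N.
Proof.
move=> ib cq; have cn : (c < n)%N by apply: ltn_trans q2n.
have := surviving_lt (inord c) ib.
by rewrite monomial_nat // pure_exp_nat // /stair cq; lia.
Qed.

Lemma full_xy_divisors : D (full_xy q) \subset Z (full_xy q).
Proof.
apply: divisors_sub_killing => [c|i]; first exact: full_xy_reduced.
rewrite inE => /mnm_lepP le; apply/negP => ib.
have := surviving_deg ib; rewrite mwdeg_1n2 (full_xy_surviving_max ib) addn0 => xd.
have : (xdeg (mon i) <= \sum_(0 <= c < n) stair (q - 2) 0 q c)%N.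
  rewrite /xdeg !big_seq; apply: leq_sum => c; rewrite mem_index_iota /= => cn.
  have [cq|cq] := ltnP c (q - 2); first by rewrite (full_xy_surviving ib cq).
  apply: leq_trans (le (inord c)) _; rewrite monomial_nat //.
  by rewrite /stair ltnNge cq.
by rewrite sum_stair muln0 q2n xd; lia.
Qed.

Lemma card_full_xy_divisors : (#|D (full_xy q)| <= d ^ (q - 2) * q.+1)%N.
Proof.
rewrite -{1}(prednK d_gt0) -[X in (_ ^ X)%N]subn0.
apply: (card_exponents (d := d) mon_inj (c0 := ord_max) (c1 := inord (q - 2))).
- by move=> i /(divisor_non_pure full_xy_reduced)/deg_mon.
- move=> i c; rewrite inE => /mnm_lepP/(_ c) le cab; apply: leq_trans le _.
  by rewrite monomial_x /stair; [case: ifP => _; [|case: ifP]; lia | lia].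
- move=> i; rewrite inE => /mnm_lepP/(_ (inord (q - 2))) le; apply: leq_trans le _.
  by rewrite monomial_nat // /stair ltnn eqxx.
move=> i c; rewrite inE => /mnm_lepP/(_ c) le /ord_lt_max cn c1 cab; apply/eqP.
rewrite -leqn0; apply: leq_trans le _.
rewrite -val_eqE /= inordK ?ltnS 1?ltnW // in c1.
by rewrite monomial_x // /stair (negPf c1); case: ifP => //; lia.
Qed.

(** For q = n + 1 all variables are saturated except x_(n-1), whose d-th
    power does not survive. *)
Lemma card_full_xy_surviving_top : q = n.+1 -> #|bad (full_xy q)| = 0%N.
Proof.
move=> qn; apply/eqP; rewrite cards_eq0 -subset0; apply/subsetP => i ib; exfalso.
have := surviving_deg ib; rewrite mwdeg_1n2 (full_xy_surviving_max ib) addn0 => xd.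
have n1 : (n.-1 < n)%N by lia.
have := surviving_lt (inord n.-1) ib.
rewrite monomial_nat // pure_exp_nat //.
have : (xdeg (mon i) <= mon i (inord n.-1))%N.
  have {1}-> : xdeg (mon i) = (\sum_(0 <= c < n.-1.+1) mon i (inord c))%N.
    by rewrite prednK //; lia.
  rewrite big_nat_recr //= big_nat big1 // => c cn.
  by apply: (full_xy_surviving ib); lia.
by rewrite xd; lia.
Qed.

(** The generators divisible by y all kill.  To see that there are at least t^n of
    them, prescribe the exponents of all variables but x_0 freely below t; the exponent
    of x_0 makes up the degree. *)
Lemma card_full_xy_killing t : (n.+1 * t <= d)%N -> (t ^ n <= #|Z (full_xy q)|)%N.
Proof.
move=> td; pose ext (f : {ffun 'I_n -> 'I_t}) c : nat :=
  if insub c is Some x then f x else 0%N.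
have extE f (x : 'I_n) : ext f x = f x by rewrite /ext valK.
have ext_lt f c : (c < n)%N -> (ext f c < t)%N.
  by move=> cn; rewrite -[c]/(val (Ordinal cn)) extE.
pose S f := (\sum_(1 <= c < n) ext f c)%N.
pose v f := monomial n (fun c => if c == 0%N then (d - (ext f 0).+1.*2 - S f)%N
                                else ext f c) (ext f 0).+1.
have vd f : mwdeg w (v f) = d.
  rewrite mwdeg_1n2 xdeg_monomial monomial_max big_ltn ?(ltnW n_gt1) //=.
  rewrite (eq_big_nat _ _ (F2 := ext f)) => [|[|c]] //; rewrite -/(S f).
  have S_le : (S f <= (n - 1) * t)%N.
    rewrite -sum_nat_const_nat /S !big_nat; apply: leq_sum => c /andP[_ cn].
    exact/ltnW/ext_lt.
  have tE : (n.+1 * t = t.*2 + (n - 1) * t)%N by clear -n_gt1; nia.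
  have e0 := ext_lt f 0%N (ltnW n_gt1).
  move: S_le e0 td; rewrite tE.
  move: (S f) (ext f 0%N) ((n - 1) * t)%N => a e P; lia.
have /fin_all_exists[idx idxE] f := irr_mon (irreducible_deg d_gt0 (vd f)).
have idx_inj : injective idx.
  move=> f h fh; apply/ffunP => x; apply: val_inj; rewrite /= -!extE.
  have vE : v f = v h by rewrite -!idxE fh.
  have [x0|x0] := posnP x.
    by have := congr1 (fun u : 'X_{1..n.+1} => u ord_max) vE; rewrite !monomial_max x0 => -[].
  have := congr1 (fun u : 'X_{1..n.+1} => u (inord x)) vE.
  by rewrite !monomial_nat //= (gtn_eqF x0).
have -> : (t ^ n = #|[set idx f | f in [set: {ffun 'I_n -> 'I_t}]]|)%N.
  by rewrite card_imset // cardsT card_ffun !card_ord.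
apply: subset_leq_card; apply/subsetP => _ /imsetP[f _ ->]; rewrite inE.
apply/andP; split; last first.
  by apply/existsP; exists ord_max; rewrite pure_exp_max d_odd idxE !monomial_max; lia.
apply/imsetP => -[c _ fc]; have := idxE f; rewrite fc mon_lam => E.
have [cm|cm] := eqVneq c ord_max.
  by have := vd f; rewrite -E cm pure_exp_max d_odd mwdeg_1n2 xdeg_ypow ypow_max; lia.
have := congr1 (fun u : 'X_{1..n.+1} => u ord_max) E.
by rewrite /v monomial_max mulmnE mnm1E (negPf cm).
Qed.

End FullXY.

(** All x_c are saturated and y^(n/2) brings the degree to dn; for odd n the exponent
    of y is rounded up and that of x_0 is lowered by one instead.  The exponent of y
    is bounded in terms of n, so divisors of degree d have n - 1 free exponents. *)
Definition near_socle :=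
  monomial n (fun c => if c == 0%N then (d.-1 - n %% 2)%N else d.-1) n.+1./2.

Section NearSocle.
Hypothesis n_lt_d : (n.+2 < d)%N.

Lemma mwdeg_near_socle : mwdeg w near_socle = (d * n)%N.
Proof.
rewrite mwdeg_1n2 xdeg_monomial monomial_max big_ltn ?(ltnW n_gt1) //=.
rewrite (eq_big_nat _ _ (F2 := fun=> d.-1)) => [|[|c]] //.
rewrite sum_nat_const_nat modn2; have := odd_double_half n.+1; rewrite /=.
by case: d d_gt0 n_lt_d => // d' _; case: n n_gt1 => // n'; case: (odd _) => /=; nia.
Qed.

Lemma near_socle_reduced c : (near_socle c < pure_exp d c)%N.
Proof.
have [->|/ord_lt_max cn] := eqVneq c ord_max.
  by rewrite monomial_max pure_exp_max; case: ifP => _; lia.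
by rewrite monomial_x // pure_exp_x //; case: ifP => _; lia.
Qed.

(** The only generator that can survive is x_0 y^((d-1)/2), because the saturated
    variables are excluded and y, of weight 2, cannot by itself have odd degree d. *)
Lemma near_socle_surviving i : i \in bad near_socle ->
  [/\ forall c, (0 < c < n)%N -> mon i (inord c) = 0%N,
      mon i (inord 0) = 1%N,
      (mon i ord_max).*2.+1 = d & odd n].
Proof.
move=> ib; have n0 := ltnW n_gt1.
have mc c : (0 < c < n)%N -> mon i (inord c) = 0%N.
  case/andP=> c0 cn; have := surviving_lt (inord c) ib.
  by rewrite monomial_nat // pure_exp_nat // (gtn_eqF c0); lia.
have m0 : (mon i (inord 0) <= n %% 2)%N.
  have := surviving_lt (inord 0) ib.
  by rewrite monomial_nat // pure_exp_nat //=; lia.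
have := surviving_deg ib; rewrite mwdeg_1n2 /xdeg big_ltn //=.
rewrite big_nat big1 // addn0 => deg.
have my := surviving_lt ord_max ib; rewrite monomial_max pure_exp_max in my.
have {my}od : odd d.
  by move: my; case: ifP => // od my; exfalso; move: (odd_double_half d); lia.
rewrite modn2 in m0; move: (odd_double_half d); rewrite od => dE.
have m1 : mon i (inord 0) = 1%N by case: (odd n) m0; lia.
split=> //; first by rewrite -deg m1.
by move: m0; rewrite m1; case: (odd n).
Qed.

Lemma near_socle_divisors : D near_socle \subset Z near_socle.
Proof.
apply: divisors_sub_killing => [c|i]; first exact: near_socle_reduced.
rewrite inE => /mnm_lepP/(_ ord_max); rewrite monomial_max => le; apply/negP.
by case/near_socle_surviving => _ _ dE _; lia.
Qed.

Lemma card_near_socle_surviving : (#|bad near_socle| <= odd d && odd n)%N.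
Proof.
have [->|[i0 i0b]] := set_0Vmem (bad near_socle); first by rewrite cards0.
have [c0 x0 y0 on] := near_socle_surviving i0b.
have od : odd d by rewrite -y0 /= odd_double.
rewrite od on -[X in (_ <= X)%N](cards1 i0); apply: subset_leq_card.
apply/subsetP => i ib; rewrite inE.
have [c1 x1 y1 _] := near_socle_surviving ib; apply/eqP/mon_inj/mnmP => c.
case: (ord_case c) => [->|[[|l] ln ->]]; first lia.
  by rewrite x0 x1.
by rewrite c0 ?c1.
Qed.

Lemma card_near_socle_divisors : (#|D near_socle| <= d ^ (n - 1) * n.+1./2.+1)%N.
Proof.
rewrite -{1}(prednK d_gt0).
apply: (card_exponents (d := d) mon_inj (c0 := inord 0) (c1 := ord_max)).
- by move=> i /(divisor_non_pure near_socle_reduced)/deg_mon.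
- move=> i c; rewrite inE => /mnm_lepP/(_ c) le cab; apply: leq_trans le _.
  by rewrite monomial_x; [case: ifP => _; lia | lia].
- by move=> i; rewrite inE => /mnm_lepP/(_ ord_max); rewrite monomial_max.
move=> i c _; rewrite -val_eqE /= inordK // => c0 /ord_lt_max; lia.
Qed.

End NearSocle.

End Families.

(** * Nonvanishing ranges *)

Lemma between_nat (a b i N : nat) :
  between a%:R (N%:R - b%:R) i -> (a <= i)%N /\ (i + b <= N)%N.
Proof.
move=> /andP[]; rewrite Num.Theory.ler_nat => ->.
by rewrite Num.Theory.lerBrDr -natrD Num.Theory.ler_nat.
Qed.

Lemma leq_expr m1 m2 e : (m1 <= m2)%N -> (m1 ^ e <= m2 ^ e)%N.
Proof. by case: e => // e; rewrite leq_exp2r. Qed.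

Lemma succ_exp_le d n m : (0 < d)%N -> (m <= n)%N ->
  (d.+1 ^ m + n <= (2 ^ n + n) * d ^ m)%N.
Proof.
move=> d0 mn; rewrite mulnDl leq_add //; last by rewrite leq_pmulr // expn_gt0 d0.
apply: leq_trans (_ : (2 * d) ^ m <= _)%N; first by apply: leq_expr; lia.
by rewrite expnMn leq_mul2r leq_pexp2l // orbT.
Qed.

(** From here on the lower bound t^n of [card_full_xy_killing], with t = d / (n + 1),
    exceeds the upper bounds on the numbers of divisors: since d <= 2(n + 1)t, it is
    enough that t is at least (n + 2)(2(n + 1))^(n - 1). *)
Definition threshold n : nat := n.+1 * (n.+2 * (2 * n.+1) ^ (n - 1)) + n + 4.

Lemma threshold_exp n d (t := (d %/ n.+1)%N) : (1 < n)%N -> (threshold n <= d)%N ->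
  (n.+2 * d ^ (n - 1) <= t ^ n)%N.
Proof.
move=> n1; rewrite /threshold; set c := (n.+2 * _)%N => dn.
have ct : (c <= t)%N.
  by rewrite leq_divRL // mulnC; apply: leq_trans dn; rewrite -addnA leq_addr.
have c0 : (0 < c)%N by rewrite muln_gt0 expn_gt0.
have dt : (d <= 2 * n.+1 * t)%N.
  have := ltn_ceil d (ltn0Sn n); rewrite -/t => lt; apply: leq_trans (ltnW lt) _.
  by rewrite [(t.+1 * _)%N]mulnC [(2 * _)%N]mulnC -mulnA leq_mul2l; apply/orP; right; lia.
have -> : (t ^ n = t * t ^ (n - 1))%N by rewrite -expnS subn1 prednK // ltnW.
apply: leq_trans (_ : n.+2 * ((2 * n.+1) ^ (n - 1) * t ^ (n - 1)) <= _)%N.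
  by rewrite leq_mul2l -expnMn leq_expr.
by rewrite mulnA leq_mul2r ct orbT.
Qed.

Theorem theorem1 (n : nat) (hn : (2 <= n)%N) :
  exists d0 : nat, forall (k : fieldType) (q : nat), (1 <= q <= n.+1)%N ->
  exists c C : rat, forall d : nat, (1 <= d)%N -> (d0 <= d)%N ->
  forall (N : nat) (z : 'I_N.+1 -> nat)
    (phi : {lrmorphism {mpoly k[N.+1]} -> veronese k (@weights_1n2 n) d}),
  minimal_surjection z phi ->
  forall i : nat, nonvanishing_range n d N q c C i ->
  betti z (M := restrict_scalars phi)
    (@veronese_deg k n.+1 (@weights_1n2 n) d) i (i + q) <> 0%N.
Proof.
exists (threshold n) => k q q_range; exists n.+2%:R, (2 ^ n + n)%N%:R => d d0 dn N z phi.
move=> phi_min i.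
have [mon [lam [inj irr irr_mon mon_lam nonzero]]] := betti_neq0 d0 phi_min.
have d_gt : (n.+2 < d)%N.
  by clear -dn; move: dn; rewrite /threshold; move: (_ * _)%N => c; lia.
have := threshold_exp hn dn; move: {dn} (d %/ n.+1)%N (leq_trunc_div d n.+1).
move=> t; rewrite mulnC => td large.
have cardZ m : (N <= #|killing d mon lam m| + n + #|surviving d mon lam m|)%N.
  exact: card_killing.
have q_le : (q.+1 <= n.+2)%N by lia.
have by_full_x : (0 < q < n)%N -> (#|divisors_of mon (full_x n d q)| <= i)%N ->
    (i + (2 ^ n + n) * d ^ (n - q) <= N)%N ->
    betti z (M := restrict_scalars phi) (@veronese_deg k n.+1 (@weights_1n2 n) d)
      i (i + q) <> 0%N.
  move=> /andP[q0 qn] lo hi; apply: (nonzero (full_x n d q)).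
  - by apply: mwdeg_full_x => //; lia.
  - by apply: full_x_divisors => //; lia.
  rewrite lo /=; have le : (n - q <= n)%N by lia.
  have := succ_exp_le d0 le; have := cardZ (full_x n d q).
  have : (#|surviving d mon lam (full_x n d q)| <= d.+1 ^ (n - q))%N.
    by apply: card_full_x_surviving => //; lia.
  move: hi; set e := ((2 ^ n + n) * _)%N; set x := (d.+1 ^ _)%N.
  by move: #|surviving _ _ _ _| #|killing _ _ _ _| => S Z; lia.
have by_full_xy : odd d -> (1 < q)%N -> (n.+2 * d ^ (q - 2) <= i)%N ->
    (i <= #|killing d mon lam (full_xy n d q)|)%N ->
    betti z (M := restrict_scalars phi) (@veronese_deg k n.+1 (@weights_1n2 n) d)
      i (i + q) <> 0%N.
  move=> od q1 lo hi; apply: (nonzero (full_xy n d q)).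
  - by apply: mwdeg_full_xy => //; lia.
  - by apply: full_xy_divisors => //; lia.
  rewrite hi andbT; apply: leq_trans lo.
  have : (#|divisors_of mon (full_xy n d q)| <= d ^ (q - 2) * q.+1)%N.
    by apply: card_full_xy_divisors => //; lia.
  by move/leq_trans; apply; rewrite mulnC leq_mul2r q_le orbT.
have by_near_socle : q = n -> (#|divisors_of mon (near_socle n d)| <= i)%N ->
    (i + n + (odd d && odd n) <= N)%N ->
    betti z (M := restrict_scalars phi) (@veronese_deg k n.+1 (@weights_1n2 n) d)
      i (i + q) <> 0%N.
  move=> qn lo hi; apply: (nonzero (near_socle n d)).
  - by rewrite qn; apply: mwdeg_near_socle => //; lia.
  - by apply: near_socle_divisors => //; lia.
  rewrite lo /=; have := cardZ (near_socle n d).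
  have : (#|surviving d mon lam (near_socle n d)| <= odd d && odd n)%N.
    by apply: card_near_socle_surviving => //; lia.
  by move: #|surviving _ _ _ _| #|killing _ _ _ _| => S Z; lia.
(* The ranges given by the two monomials overlap. *)
have overlap : odd d -> (1 < q)%N ->
    (n.+2 * d ^ (n - 1) <= #|killing d mon lam (full_xy n d q)|)%N.
  move=> od q1; apply: leq_trans large _.
  by clear -hn d0 inj irr irr_mon mon_lam od td q1 d_gt q_range; apply: card_full_xy_killing => //; lia.
have full_x_le : (0 < q < n)%N ->
    (#|divisors_of mon (full_x n d q)| <= n.+2 * d ^ (q - 1))%N.
  case/andP=> q0 qn; have : (#|divisors_of mon (full_x n d q)| <= d ^ (q - 1) * q.+1)%N.
    by apply: card_full_x_divisors => //; lia.
  by move/leq_trans; apply; rewrite mulnC leq_mul2r q_le orbT.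
have near_socle_le : (#|divisors_of mon (near_socle n d)| <= n.+2 * d ^ (n - 1))%N.
  have : (#|divisors_of mon (near_socle n d)| <= d ^ (n - 1) * n.+1./2.+1)%N.
    by apply: card_near_socle_divisors => //; lia.
  move/leq_trans; apply; rewrite mulnC leq_mul2r ltnS; apply/orP; right.
  by rewrite -divn2 leq_div.
have case1 : q = 1%N ->
    between 1 (N%:R - (2 ^ n + n)%N%:R * d%:R ^+ (n - 1)) i ->
    betti z (M := restrict_scalars phi) (@veronese_deg k n.+1 (@weights_1n2 n) d)
      i (i + q) <> 0%N.
  move=> q1; rewrite -natrX -natrM => b.
  have [lo hi] := @between_nat 1 _ _ _ b.
  apply: by_full_x; rewrite q1 //; apply: leq_trans lo.
  by apply: card_full_x1_divisors => //; lia.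
have between_pow a b : between (n.+2%:R * d%:R ^+ a)
      (N%:R - (2 ^ n + n)%N%:R * d%:R ^+ b) i ->
    (n.+2 * d ^ a <= i)%N /\ (i + (2 ^ n + n) * d ^ b <= N)%N.
  rewrite -!natrX -!natrM => e.
  exact: (between_nat e).
rewrite /nonvanishing_range; case: ifP => od.
  case=> [[q1 b]|[qr b]|[qn b]|[qn b]]; first exact: case1.
  - have [lo hi] := between_pow _ _ b.
    have [q1 qn] : (1 < q)%N /\ (0 < q < n)%N by clear -qr; lia.
    have [iB|Bi] := leqP i #|killing d mon lam (full_xy n d q)|.
      by apply: by_full_xy.
    apply: by_full_x => //; apply: leq_trans (full_x_le qn) _.
    apply: leq_trans (ltnW Bi); apply: leq_trans (overlap od q1).
    rewrite leq_mul2l leq_pexp2l //; by case/andP: qn => _ /ltnW qn; rewrite leq_sub2r.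
  - move: b; rewrite -natrX -natrM -addrA -opprD -natrD => b.
    have [lo hi] := between_nat b.
    have q1 : (1 < q)%N by rewrite qn.
    have [iB|Bi] := leqP i #|killing d mon lam (full_xy n d q)|.
      by apply: by_full_xy => //; rewrite qn.
    apply: by_near_socle => //; last by move: hi; rewrite modn2 od /= -addnA.
    apply: leq_trans near_socle_le _; apply: leq_trans (ltnW Bi).
    exact: overlap.
  move: b; rewrite -natrX -natrM => b; have [lo hi] := between_nat b.
  have q1 : (1 < q)%N by rewrite qn ltnS ltnW.
  apply: by_full_xy => //; first by rewrite qn subSS.
  have := cardZ (full_xy n d q).
  have -> : #|surviving d mon lam (full_xy n d q)| = 0%N.
    by apply: card_full_xy_surviving_top => //; rewrite ltnW.
  rewrite addn0 => h; rewrite -(leq_add2r n); exact: leq_trans hi h.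
case=> [[q1 b]|[qr b]|[qn b]]; first exact: case1.
- have [lo hi] := between_pow _ _ b.
  have qn : (0 < q < n)%N by clear -qr; lia.
  by apply: by_full_x => //; apply: leq_trans (full_x_le qn) lo.
move: b; rewrite -natrX -natrM => b; have [lo hi] := between_nat b.
apply: by_near_socle => //; last by rewrite od addn0.
exact: leq_trans near_socle_le lo.
Qed.
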